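(* Let $S=K[x_1,\dots,x_n]$ be a polynomial ring over a field $K$. Let $I\subseteq S$ be a monomial ideal generated by monomials of the same degree $d$, with linear powers, and suppose that for every $k\ge 1$ the ideal $I^k$ has no embedded associated primes. Then for every $k\ge 1$, $$\mathrm{v}(I^k)=\alpha(I)\,k-1.$$
   Context: $S$ is standard graded. $\alpha(I)$ denotes the smallest degree of a monomial in $I$. $I$ has linear powers if $I^k$ has a linear resolution for every $k\ge1$. An ideal has no embedded associated primes if there are no proper inclusions among its associated primes. The v-number: for a graded ideal $I\subseteq S$ with $\mathfrak m=(x_1,\dots,x_n)$, $\mathrm{v}(I)=\min\{d\ge 1 : \text{there exist } f\in S_d \text{ and } \mathfrak p\in \mathrm{Ass}(I) \text{ with } (I:f)=\mathfrak p\}$ if $I\subsetneq\mathfrak m$, and $\mathrm{v}(\mathfrak m)=0$. Here $S_d$ is the degree-$d$ component and $\mathrm{Ass}(I)$ is the set of associated primes of $S/I$.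
   Formalization: I is taken proper and nonzero, and the case where I^k is a prime other than the graded maximal ideal is excluded: there the claim fails with the minimum over d ≥ 1, e.g. I=(x1) in K[x1,x2] has v(I)=1 but α(I)−1=0. *)

(* Defs.v *)
From HB Require Import structures.
From mathcomp Require Import all_boot all_order all_algebra.
From mathcomp Require Export mpoly.
Set Implicit Arguments.
Unset Strict Implicit.
Unset Printing Implicit Defensive.
Import GRing.Theory.
Local Open Scope ring_scope.

Section Ideals.
Variables (K : fieldType) (n : nat).
Local Notation S := {mpoly K[n]}.

(* Ideals are arbitrary (not necessarily decidable) subsets of S, compared
   extensionally. *)
Definition is_ideal (I : S -> Prop) : Prop :=
  [/\ I 0,
      forall f g, I f -> I g -> I (f + g)
    & forall r f, I f -> I (r * f)].

Definition ideal_sub (I J : S -> Prop) : Prop := forall f, I f -> J f.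

Definition ideal_eq (I J : S -> Prop) : Prop := forall f, I f <-> J f.

Definition ideal_gen (G : S -> Prop) (f : S) : Prop :=
  exists (m : nat) (c g : 'I_m -> S),
    (forall i, G (g i)) /\ f = \sum_(i < m) c i * g i.

Definition ideal_mul (I J : S -> Prop) : S -> Prop :=
  ideal_gen (fun h => exists f g, [/\ I f, J g & h = f * g]).

Fixpoint ideal_pow (I : S -> Prop) (k : nat) : S -> Prop :=
  if k is k'.+1 then ideal_mul I (ideal_pow I k') else fun=> True.

(* The graded maximal ideal (x_1, ..., x_n). *)
Definition maxideal : S -> Prop :=
  ideal_gen (fun f => exists i : 'I_n, f = 'X_i).

Definition colon (I : S -> Prop) (f : S) : S -> Prop := fun g => I (g * f).

Definition prime_ideal (p : S -> Prop) : Prop :=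
  [/\ is_ideal p, ~ p 1 & forall f g, p (f * g) -> p f \/ p g].

(* p is an associated prime of S/I, i.e. the annihilator of the class of some
   f in S. *)
Definition associated (I p : S -> Prop) : Prop :=
  prime_ideal p /\ exists f, ideal_eq (colon I f) p.

Definition no_embedded_primes (I : S -> Prop) : Prop :=
  forall p q, associated I p -> associated I q ->
    ideal_sub p q -> ideal_eq p q.

Definition generated_by_monomials_of_degree (I : S -> Prop) (d : nat) : Prop :=
  exists G : 'X_{1..n} -> Prop,
    (forall m, G m -> mdeg m = d) /\
    ideal_eq I (ideal_gen (fun f => exists m, G m /\ f = 'X_[m])).

Definition is_alpha (I : S -> Prop) (a : nat) : Prop :=
  (exists m : 'X_{1..n}, I 'X_[m] /\ mdeg m = a) /\
  (forall m : 'X_{1..n}, I 'X_[m] -> (a <= mdeg m)%N).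

Definition v_witness (I : S -> Prop) (d : nat) : Prop :=
  exists (f : S) (p : S -> Prop),
    [/\ f \is d.-homog, associated I p & ideal_eq (colon I f) p].

(* v(I) = v.  The relation is functional in v; it has no value v when I is not
   contained in the graded maximal ideal or when no witness exists. *)
Definition is_vnumber (I : S -> Prop) (v : nat) : Prop :=
  (ideal_eq I maxideal /\ v = 0%N) \/
  [/\ ideal_sub I maxideal, ~ ideal_eq I maxideal,
      (1 <= v)%N /\ v_witness I v
    & forall d, (1 <= d)%N -> v_witness I d -> (v <= d)%N].

(* Data of a complex  ... -> F_2 -> F_1 -> F_0 -> S  of graded free modules:
   F_i has the basis indexed by 'I_(rk i), whose q-th element has degree
   shift i q, i.e. F_i is the direct sum of the S(- shift i q).  Elements of
   F_i are column vectors; aug is the map F_0 -> S and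
   diff i the map F_(i+1) -> F_i. *)
Record free_complex := FreeComplex {
  rk : nat -> nat;
  shift : forall i, 'I_(rk i) -> nat;
  aug : 'rV[S]_(rk 0);
  diff : forall i, 'M[S]_(rk i, rk i.+1)
}.

(* An entry sending a basis element of degree t to a multiple of a basis element
   of degree s is homogeneous of degree t - s, hence zero when t < s. *)
Definition homog_entry (s t : nat) (f : S) : Prop :=
  if (s <= t)%N then is_true (f \is (t - s).-homog) else f = 0.

Definition graded_complex (F : free_complex) : Prop :=
  (forall q, homog_entry 0 (shift q) (aug F ord0 q)) /\
  (forall i p q, homog_entry (shift p) (shift q) (diff F i p q)).

Definition resolves (F : free_complex) (I : S -> Prop) : Prop :=
  [/\ forall f, I f <-> exists v : 'cV[S]_(rk F 0), (aug F *m v) ord0 ord0 = f,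
      forall v : 'cV[S]_(rk F 0),
        aug F *m v = 0 <-> exists w, v = diff F 0 *m w
    & forall i (v : 'cV[S]_(rk F i.+1)),
        diff F i *m v = 0 <-> exists w, v = diff F i.+1 *m w].

Definition minimal_complex (F : free_complex) : Prop :=
  forall i p q, maxideal (diff F i p q).

Definition minimal_graded_free_resolution
    (F : free_complex) (I : S -> Prop) : Prop :=
  [/\ graded_complex F, resolves F I & minimal_complex F].

(* Minimal graded free resolutions are unique up to isomorphism, so it does not
   matter which one is tested. *)
Definition has_linear_resolution (I : S -> Prop) : Prop :=
  exists (d : nat) (F : free_complex),
    minimal_graded_free_resolution F I /\
    (forall i (q : 'I_(rk F i)), shift q = (d + i)%N).

Definition has_linear_powers (I : S -> Prop) : Prop :=
  forall k, (1 <= k)%N -> has_linear_resolution (ideal_pow I k).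

End Ideals.

Arguments maxideal {K n} _.

(* Main.v *)
(* Put J = I^k, generated in degree D = d k.  The bound v(J) >= D - 1 holds since
   an associated prime contains a variable and J starts in degree D.  For the
   converse one needs a monomial v of degree D - 1 with (J : v) prime.

   Choose N and a monomial w of degree D N - 1 such that the set C of variables
   x_i with x_i w in J^N is as large as possible.  Multiplying witnesses shows
   that C is closed under the linear relations x_i u = x_j u' between generators
   of J.  As the first syzygies of J are linear, all generators of J then have the
   same degree c in the variables of C, and c > 0, so J is contained in
   p = (x_i : i in C).  The ideal (J^N : w) contains p, so some associated prime of
   J^N contains p; another one is contained in p.  Since J^N has no embedded
   primes, both equal p, and p is a minimal prime of J.  In particular p u is
   contained in J for some monomial u outside J.

   Let h = |C| and let s >= c - 1 be the C-degree of u.  The elements of (J : p)/J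
   of C-degree s are the top Koszul homology of S/J on the variables of C, in
   C-degree s + h; in that C-degree the lower Koszul homology on C vanishes,
   because J has a linear resolution and its elements have degree at least D - c
   in the other variables.  Adding the other variables one at a time therefore
   identifies the generators of the top homology with Koszul homology on all
   variables, which is concentrated in total degree D + h - 1.  Since u makes the
   top homology nonzero, it contains a monomial v of degree D - 1 with p v in J.
   This forces s = c - 1, so that v has C-degree c - 1 and (J : v) = p. *)
Require Import Defs.
From HB Require Import structures.
From mathcomp Require Import all_boot all_order all_algebra.
From mathcomp Require Import mpoly.
From mathcomp Require Import zify ring.
From Stdlib Require Import Classical_Prop.
Set Implicit Arguments.
Unset Strict Implicit.
Unset Printing Implicit Defensive.
Import GRing.Theory.
Local Open Scope ring_scope.

(** * The Koszul complex *)

Section KoszulComplex.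
Variable n : nat.

(* The Koszul complex on a list of variables is encoded as the iterated mapping
   cone: over [y :: s] a chain is a pair [(z0, z1)] standing for
   [z0 + e_y z1], where [z0] and [z1] are chains over [s]. *)
Fixpoint koszul (V : zmodType) (s : seq 'I_n) : zmodType :=
  if s is _ :: s' then (koszul V s' * koszul V s')%type else V.

Fixpoint kmap (V W : zmodType) (f : V -> W) (s : seq 'I_n) :
    koszul V s -> koszul W s :=
  match s with
  | [::] => f
  | _ :: s' => fun z => (kmap f z.1, kmap f z.2)
  end.

(* [kdeg P i z]: the chain [z] has homological degree [i], with coefficients
   in [P]. *)
Fixpoint kdeg (V : zmodType) (P : V -> Prop) (i : nat) (s : seq 'I_n) :
    koszul V s -> Prop :=
  match s with
  | [::] => fun v => if i is 0%N then P v else v = 0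
  | _ :: s' => fun z =>
      kdeg P i z.1 /\ (if i is i'.+1 then kdeg P i' z.2 else z.2 = 0)
  end.

Section Maps.
Variables (V W : zmodType) (f : {additive V -> W}).

Lemma kmapD s : {morph @kmap V W f s : z w / z + w}.
Proof.
elim: s => [|y s IHs] z w /=; first exact: raddfD.
by rewrite !IHs.
Qed.

Lemma kmap0 s : @kmap V W f s 0 = 0.
Proof. by elim: s => [|y s IHs] /=; rewrite ?raddf0 // !IHs. Qed.

Lemma kmapN s : {morph @kmap V W f s : z / - z}.
Proof.
elim: s => [|y s IHs] z /=; first exact: raddfN.
by rewrite !IHs.
Qed.

Lemma kdeg_map (P : V -> Prop) (Q : W -> Prop) i s (z : koszul V s) :
  (forall v, P v -> Q (f v)) -> kdeg P i z -> kdeg Q i (kmap f z).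
Proof.
move=> PQ; elim: s i z => [|y s IHs] [|i] z //=.
- exact: PQ.
- by move=> ->; rewrite raddf0.
- by case=> /IHs H ->; rewrite kmap0.
- by case=> /IHs H /IHs H'.
Qed.

Lemma kdeg_lift (P : V -> Prop) (Q : W -> Prop) i s (z : koszul W s) :
  (forall w, Q w -> exists2 v, P v & f v = w) ->
  kdeg Q i z -> exists2 z', kdeg P i z' & kmap f z' = z.
Proof.
move=> QP; elim: s i z => [|y s IHs] [|i] z /=.
- exact: QP.
- by move=> ->; exists 0; rewrite ?raddf0.
- case=> /IHs[z0 dz0 e0] z1; exists (z0, 0) => //=.
  by rewrite e0 kmap0 -z1 -surjective_pairing.
- case=> /IHs[z0 dz0 e0] /IHs[z1 dz1 e1]; exists (z0, z1) => //=.
  by rewrite e0 e1 -surjective_pairing.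
Qed.

End Maps.

Lemma kmap_comp (U V W : zmodType) (f : V -> W) (g : U -> V) s z :
  @kmap U W (f \o g) s z = kmap f (kmap g z).
Proof. by elim: s z => [|y s IHs] z //=; rewrite !IHs. Qed.

Lemma eq_kmap (V W : zmodType) (f g : V -> W) s :
  f =1 g -> @kmap V W f s =1 @kmap V W g s.
Proof. by move=> fg; elim: s => [|y s IHs] z //=; rewrite ?IHs ?fg. Qed.

Lemma kmap_id (V : zmodType) s z : @kmap V V idfun s z = z.
Proof. by elim: s z => [|y s IHs] z //=; rewrite !IHs -surjective_pairing. Qed.

Section Predicates.
Variables (V : zmodType).

Lemma kdeg_sub (P Q : V -> Prop) i s (z : koszul V s) :
  (forall v, P v -> Q v) -> kdeg P i z -> kdeg Q i z.
Proof.
move=> PQ; elim: s i z => [|y s IHs] [|i] z //=; first exact: PQ.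
  by case=> /IHs.
by case=> /IHs H /IHs H'.
Qed.

Lemma kdeg0 (P : V -> Prop) i s : P 0 -> kdeg P i (0 : koszul V s).
Proof. by move=> P0; elim: s i => [|y s IHs] [|i] //=; split. Qed.

Lemma kdegD (P : V -> Prop) i s (z w : koszul V s) :
  (forall u v, P u -> P v -> P (u + v)) ->
  kdeg P i z -> kdeg P i w -> kdeg P i (z + w).
Proof.
move=> PD; elim: s i z w => [|y s IHs] [|i] z w /=.
- exact: PD.
- by move=> -> ->; rewrite addr0.
- by case=> z0 -> [w0 ->]; rewrite addr0; split=> //; apply: IHs.
- by case=> z0 z1 [w0 w1]; split; apply: IHs.
Qed.

Lemma kdegN (P : V -> Prop) i s (z : koszul V s) :
  (forall u, P u -> P (- u)) -> kdeg P i z -> kdeg P i (- z).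
Proof.
move=> PN; elim: s i z => [|y s IHs] [|i] z /=.
- exact: PN.
- by move=> ->; rewrite oppr0.
- by case=> z0 ->; rewrite oppr0; split=> //; apply: IHs.
- by case=> z0 z1; split; apply: IHs.
Qed.

End Predicates.

Section Boundary.
Variables (V : zmodType) (act : 'I_n -> {additive V -> V}).
Hypothesis actC : forall i j v, act i (act j v) = act j (act i v).

Fixpoint kbd (s : seq 'I_n) : koszul V s -> koszul V s :=
  match s with
  | [::] => fun=> 0
  | y :: s' => fun z => (kbd z.1 + kmap (act y) z.2, - kbd z.2)
  end.

Lemma kbdD s : {morph @kbd s : z w / z + w}.
Proof.
elim: s => [|y s IHs] z w /=; first by rewrite addr0.
by rewrite !IHs kmapD opprD addrACA.
Qed.

Lemma kbd0 s : @kbd s 0 = 0.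
Proof. by elim: s => [|y s IHs] //=; rewrite !IHs kmap0 oppr0 addr0. Qed.

Lemma kbdN s : {morph @kbd s : z / - z}.
Proof.
by move=> z; apply: (addrI (kbd z)); rewrite -kbdD !subrr kbd0.
Qed.

Lemma kbdB s : {morph @kbd s : z w / z - w}.
Proof. by move=> z w; rewrite kbdD kbdN. Qed.

Lemma kbd_deg0 P s (z : koszul V s) : kdeg P 0 z -> kbd z = 0.
Proof.
elim: s z => [|y s IHs] z //= [/IHs-> ->].
by rewrite kmap0 kbd0 oppr0 addr0.
Qed.

Lemma kbd_kmap_act j s z : @kbd s (kmap (act j) z) = kmap (act j) (kbd z).
Proof.
elim: s z => [|y s IHs] z /=; first by rewrite raddf0.
rewrite !IHs kmapD kmapN -!kmap_comp; congr (_ + _, _).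
by apply: eq_kmap => v /=; rewrite actC.
Qed.

Lemma kbdK s z : @kbd s (kbd z) = 0.
Proof.
elim: s z => [|y s IHs] z //=.
by rewrite kbdD !IHs add0r kbd_kmap_act kmapN subrr kbdN IHs !oppr0.
Qed.

Lemma kbd_deg (P : V -> Prop) i s (z : koszul V s) :
    P 0 -> (forall u v, P u -> P v -> P (u + v)) ->
    (forall u, P u -> P (- u)) -> (forall j u, P u -> P (act j u)) ->
  kdeg P i.+1 z -> kdeg P i (kbd z).
Proof.
move=> P0 PD PN Pa; elim: s i z => [|y s IHs] i z /=.
  by move=> _; case: i.
case=> /IHs z0 z1; split; last first.
  by case: i z0 z1 => [|i] z0 z1; [rewrite (kbd_deg0 z1) oppr0 | apply/kdegN/IHs].
apply: kdegD => //; apply: kdeg_map z1 => v; exact: Pa.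
Qed.

End Boundary.

Lemma kbd_kmap (V W : zmodType) (actV : 'I_n -> {additive V -> V})
    (actW : 'I_n -> {additive W -> W}) (f : {additive V -> W}) s z :
  (forall j v, f (actV j v) = actW j (f v)) ->
  kbd actW (kmap f z) = kmap f (@kbd V actV s z).
Proof.
move=> fact; elim: s z => [|y s IHs] z /=; first by rewrite raddf0.
rewrite !IHs kmapD kmapN -!kmap_comp; congr (_ + _, _).
by apply: eq_kmap => v /=; rewrite fact.
Qed.

End KoszulComplex.

(** * Ideals generated by variables *)

Section VariableIdeals.
Variables (K : fieldType) (n : nat).
Local Notation S := {mpoly K[n]}.

Lemma mcoeffXM (y : 'I_n) (f : S) m :
  ('X_y * f)@_m = if m y == 0%N then 0 else f@_(m - U_(y)).
Proof.
rewrite mulrC; case: eqP => [my0|/eqP my0].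
  apply/eqP; rewrite mcoeff_eq0 (perm_mem (msuppMX f U_(y))).
  apply/mapP => -[m' _ em]; move: my0.
  by rewrite em mnmDE mnm1E eqxx.
have {1}<- : (U_(y) + (m - U_(y)))%MM = m; last by rewrite mcoeffMX.
by apply/mnmP => j; rewrite mnmDE mnmBE mnm1E; case: eqP => [<-|_] /=; lia.
Qed.

(** The ideal generated by the variables in [s], described through supports so that membership is
    tested monomial by monomial. *)
Definition varideal (s : seq 'I_n) (f : S) : Prop :=
  forall m, m \in msupp f -> has (fun j => m j != 0%N) s.

Lemma varideal0 s : varideal s 0.
Proof. by move=> m; rewrite msupp0. Qed.

Lemma varidealD s f g : varideal s f -> varideal s g -> varideal s (f + g).
Proof.
move=> hf hg m /msuppD_le; rewrite mem_cat => /orP[] //; [exact: hf|exact: hg].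
Qed.

Lemma varidealMl s r f : varideal s f -> varideal s (r * f).
Proof.
move=> hf m /msuppM_le/allpairsP[[m1 m2] /= [_ /hf/hasP[j js mj] ->]].
by apply/hasP; exists j; rewrite // mnmDE addn_eq0 negb_and mj orbT.
Qed.

Lemma varidealN s f : varideal s f -> varideal s (- f).
Proof. by rewrite -mulN1r; apply: varidealMl. Qed.

Lemma varideal_ideal s : is_ideal (varideal s).
Proof.
split; [exact: varideal0|exact: varidealD|exact: varidealMl].
Qed.

Lemma varidealX s (m : 'X_{1..n}) :
  varideal s 'X_[m] <-> has (fun j => m j != 0%N) s.
Proof.
split=> [|h m']; first by apply; rewrite msuppX mem_head.
by rewrite msuppX inE => /eqP->.
Qed.

Lemma varidealXU (s : seq 'I_n) y : y \in s -> varideal s 'X_y.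
Proof.
by move=> ys; apply/varidealX/hasP; exists y; rewrite // mnm1E eqxx.
Qed.

Lemma varideal_sub (s t : seq 'I_n) f :
  {subset s <= t} -> varideal s f -> varideal t f.
Proof.
move=> st hf m /hf/hasP[j js mj]; apply/hasP; exists j => //; exact: st.
Qed.

Lemma varideal_nil f : varideal [::] f -> f = 0.
Proof.
move=> hf; apply: msuppnil0; case e: (msupp f) => [//|m l].
by have := hf m; rewrite e mem_head => /(_ isT).
Qed.

Lemma varideal_cons y s f : varideal (y :: s) f ->
  exists f0 f1, varideal s f0 /\ f = f0 + 'X_y * f1.
Proof.
move=> hf; rewrite (mpolyE f) big_seq_cond; apply: (big_ind (fun g => exists f0 f1,
  varideal s f0 /\ g = f0 + 'X_y * f1)).
- by exists 0, 0; split; [exact: varideal0 | rewrite mulr0 addr0].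
- move=> _ _ [f0 [f1 [h ->]]] [g0 [g1 [h' ->]]].
  exists (f0 + g0), (f1 + g1); split; first exact: varidealD.
  by rewrite mulrDr addrACA.
move=> m /andP[/hf /= hm _]; have [my|my] := eqVneq (m y) 0%N.
  exists (f@_m *: 'X_[m]), 0; rewrite mulr0 addr0; split=> //.
  by rewrite -mul_mpolyC; apply/varidealMl/varidealX; move: hm; rewrite my.
exists 0, (f@_m *: 'X_[m - U_(y)]); split; first exact: varideal0.
rewrite add0r -scalerAr -mpolyXD; congr (_ *: 'X_[_]).
by apply/mnmP => j; rewrite mnmDE mnmBE mnm1E; case: eqP => [<-|_] /=; lia.
Qed.

Lemma varideal_regular y s f :
  y \notin s -> varideal s ('X_y * f) -> varideal s f.
Proof.
move=> ys hf m mf.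
have /hf/hasP[j js] : (m + U_(y))%MM \in msupp ('X_y * f).
  by rewrite mulrC addmC (perm_mem (msuppMX f U_(y))); apply: map_f.
rewrite mnmDE mnm1E => mj; apply/hasP; exists j => //; move: mj.
by case: (y =P j) ys => [->|_ _]; rewrite ?js // addn0.
Qed.

(** For a product in the ideal, each factor splits into a part in the ideal and a part whose
    monomials avoid [s]. The product of the two avoiding parts lies in the ideal and still avoids
    [s], so it vanishes and one of them is zero. *)
Lemma varideal_prime s : prime_ideal (varideal s).
Proof.
split; first exact: varideal_ideal.
  move=> /(_ 0%MM); rewrite msupp1 mem_head => /(_ isT)/hasP[j _].
  by rewrite mnm0E.
have split f : exists f0 f1, [/\ varideal s f0, f = f0 + f1 &
    forall m, m \in msupp f1 -> ~~ has (fun j => m j != 0%N) s].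
  exists (\sum_(m <- msupp f | has (fun j => m j != 0%N) s) f@_m *: 'X_[m]),
    (\sum_(m <- msupp f | ~~ has (fun j => m j != 0%N) s) f@_m *: 'X_[m]).
  split; last 2 first.
  - rewrite [LHS]mpolyE.
    by rewrite (bigID (fun m : 'X_{1..n} => has (fun j => m j != 0%N) s)).
  - move=> m /msupp_sum_le/flattenP[l /mapP[m']].
    rewrite mem_filter => /andP[hm' m'f] ->.
    by move/msuppZ_le; rewrite msuppX inE => /eqP->.
  apply: (big_ind (varideal s)); [exact: varideal0|exact: varidealD|].
  by move=> m hm; rewrite -mul_mpolyC; apply/varidealMl/varidealX.
move=> f g; have [f0 [f1 [hf0 -> hf1]]] := split f.
have [g0 [g1 [hg0 -> hg1]]] := split g => hfg.
have h11 : varideal s (f1 * g1).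
  have -> : f1 * g1 = (f0 + f1) * (g0 + g1) - (f1 * g0 + (g0 + g1) * f0).
    by ring.
  by apply: varidealD => //; apply/varidealN/varidealD; apply: varidealMl.
have /eqP : f1 * g1 = 0.
  apply: msuppnil0; case e: (msupp _) => [//|m l].
  have mfg : m \in msupp (f1 * g1) by rewrite e mem_head.
  have /hasP[j js] := h11 m mfg.
  case/msuppM_le/allpairsP: mfg => -[m1 m2] /= [/hf1 h1 /hg1 h2 ->].
  rewrite mnmDE addn_eq0 negb_and => /orP[] mj.
    by case/hasP: h1; exists j.
  by case/hasP: h2; exists j.
by rewrite mulf_eq0 => /orP[]/eqP->; rewrite addr0; [left|right].
Qed.

End VariableIdeals.

(** * Exactness of the Koszul complex with free coefficients *)

Section KoszulExact.
Variables (K : fieldType) (n : nat).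
Local Notation S := {mpoly K[n]}.

Definition actX (r : nat) (j : 'I_n) : {additive 'cV[S]_r -> 'cV[S]_r} :=
  GRing.scale ('X_j : S).

Lemma actXC r i j v : actX r i (actX r j v) = actX r j (actX r i v).
Proof. by rewrite /actX /= !scalerA mulrC. Qed.

Lemma actX_mulmx r r' (A : 'M[S]_(r', r)) j v :
  A *m (actX r j v) = actX r' j (A *m v).
Proof. by rewrite /actX /= scalemxAr. Qed.

(** The coefficient of the empty face; it determines a chain of homological degree 0. *)
Fixpoint kroot (V : zmodType) (s : seq 'I_n) : koszul V s -> V :=
  match s with [::] => id | _ :: s' => fun z => kroot z.1 end.

Lemma krootD V s (z w : koszul V s) : kroot (z + w) = kroot z + kroot w.
Proof. by elim: s z w => [|y s IHs] z w //=; rewrite IHs. Qed.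

Lemma kroot_map (V W : zmodType) (f : V -> W) s z :
  kroot (@kmap n V W f s z) = f (kroot z).
Proof. by elim: s z => [|y s IHs] z //=; rewrite IHs. Qed.

Lemma kroot_inj V P Q s (z w : koszul V s) :
  kdeg P 0 z -> kdeg Q 0 w -> kroot z = kroot w -> z = w.
Proof.
elim: s z w => [|y s IHs] z w //= [z0 z1] [w0 w1] /(IHs _ _ z0 w0) e.
by rewrite (surjective_pairing z) (surjective_pairing w) e z1 w1.
Qed.

Fixpoint kconst (V : zmodType) (v : V) (s : seq 'I_n) : koszul V s :=
  match s with [::] => v | _ :: s' => (kconst v s', 0) end.

Lemma kroot_const (V : zmodType) (v : V) s : kroot (kconst v s) = v.
Proof. by elim: s => [|y s IHs]. Qed.

Lemma kdeg_const (V : zmodType) (P : V -> Prop) v s :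
  P v -> kdeg P 0 (kconst v s).
Proof. by move=> Pv; elim: s. Qed.

Local Notation any := (fun=> True).

Definition varcol r (s : seq 'I_n) (v : 'cV[S]_r) : Prop :=
  forall q, varideal s (v q 0).

Lemma kroot_boundary r s (z : koszul 'cV[S]_r s) :
  varcol s (kroot (kbd (@actX r) z)).
Proof.
elim: s z => [|y s IHs] z q /=; first by rewrite mxE; exact: varideal0.
rewrite krootD kroot_map !mxE; apply: varidealD.
  by apply: varideal_sub (IHs _ _) => j js; rewrite inE js orbT.
by rewrite mulrC; apply/varidealMl/varidealXU/mem_head.
Qed.

Lemma varcol_boundary r s (v : 'cV[S]_r) : varcol s v ->
  exists2 z : koszul 'cV[S]_r s, kdeg any 1 z & kroot (kbd (@actX r) z) = v.
Proof.
elim: s v => [|y s IHs] v hv /=.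
  exists 0 => //; apply/colP => q; rewrite mxE.
  by rewrite (varideal_nil (hv q)).
have /fin_all_exists[g /fin_all_exists[h gh]] q := varideal_cons (hv q).
have [|z dz ez] := IHs (\col_q g q).
  by move=> q; rewrite mxE; case: (gh q).
exists (z, kconst (\col_q h q) s) => /=.
  by split=> //; apply: kdeg_const.
rewrite krootD kroot_map ez kroot_const; apply/colP => q; rewrite !mxE.
by case: (gh q).
Qed.

(** For a cycle [z0 + e_y z1], the chain [z1] is a cycle over [s]; once it is bounded by [w1], the
    chain [z0 + y w1] is a cycle over [s] as well. If [z1] has degree 0, it is a boundary because
    [y] is regular modulo the variables in [s]. *)
Lemma koszul_exact r s i (z : koszul 'cV[S]_r s) :
    uniq s -> kdeg any i.+1 z -> kbd (@actX r) z = 0 ->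
  exists2 w, kdeg any i.+2 w & kbd (@actX r) w = z.
Proof.
elim: s i z => [|y s IHs] i z /=; first by move=> _ ->; exists 0.
case/andP=> ys us [dz0 dz1] [ez0 ez1].
have {}ez1 : kbd (@actX r) z.2 = 0 by rewrite -[LHS]opprK ez1 oppr0.
have [w1 dw1 ew1] : exists2 w, kdeg any i.+1 w & kbd (@actX r) w = z.2.
  case: i {dz0} dz1 => [|i] dz1; last exact: IHs.
  have [|w dw ew] := @varcol_boundary r s (kroot z.2); last first.
    exists w => //; apply: kroot_inj dz1 ew.
    by apply: kbd_deg dw.
  move=> q; apply: (varideal_regular ys).
  have := congr1 (fun w : koszul 'cV[S]_r s => kroot w q 0) ez0.
  rewrite krootD kroot_map !mxE.
  have -> : kroot (0 : koszul 'cV[S]_r s) = 0 by elim: (s).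
  rewrite mxE => /eqP; rewrite addrC addr_eq0 => /eqP->.
  exact/varidealN/kroot_boundary.
have [||w0 dw0 ew0] := IHs i (z.1 + kmap (actX r y) w1) us.
- apply: kdegD => //; exact: kdeg_map dw1.
- by rewrite kbdD (kbd_kmap_act (@actXC r)) ew1.
exists (w0, - w1) => /=; first by split=> //; apply: kdegN.
by rewrite ew0 kmapN addrK kbdN opprK ew1 -surjective_pairing.
Qed.

End KoszulExact.

(** * Multigraded Koszul chains of a monomial ideal *)

Section Monomials.
Variable n : nat.
Implicit Types (A : 'X_{1..n} -> Prop) (m b u : 'X_{1..n}).

Lemma subUK b y : b y != 0%N -> (b - U_(y) + U_(y))%MM = b.
Proof. by move=> by0; rewrite submK // lep1mP. Qed.

Lemma subUC b i j : (b - U_(i) - U_(j))%MM = (b - U_(j) - U_(i))%MM.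
Proof. by apply/mnmP => l; rewrite !mnmBE; lia. Qed.

Lemma mdeg_subU b y : b y != 0%N -> mdeg b = (mdeg (b - U_(y))).+1.
Proof. by move=> by0; rewrite -{1}(subUK by0) mdegD mdeg1 addn1. Qed.

Lemma exists_lt_mnm u b : (u <= b)%MM -> (mdeg u < mdeg b)%N ->
  exists2 i, b i != 0%N & (u <= b - U_(i))%MM.
Proof.
move=> /mnm_lepP ub lt.
have [i ui] : exists i, (u i < b i)%N.
  apply/existsP; apply: contraTT lt => /existsPn h; rewrite -leqNgt !mdegE.
  by apply: leq_sum => i _; rewrite leqNgt.
exists i; first by rewrite -lt0n; apply: leq_ltn_trans ui.
apply/mnm_lepP => j; rewrite mnmBE mnm1E.
by case: (i =P j) => [<-|_] /=; [lia | rewrite subn0].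
Qed.

Lemma exists_var m : (0 < mdeg m)%N -> exists i, m i != 0%N.
Proof.
move=> m_gt0; have [||i mi _] := @exists_lt_mnm 0%MM m; last by exists i.
  by apply/mnm_lepP => i; rewrite mnm0E.
by rewrite mdeg0.
Qed.

Definition upclosed A : Prop := forall m j, A m -> A (m + U_(j))%MM.

Definition generated_in A (D : nat) : Prop :=
  forall m, A m -> exists u, [/\ A u, mdeg u = D & (u <= m)%MM].

Lemma generated_in_mdeg A D m : generated_in A D -> A m -> (D <= mdeg m)%N.
Proof.
by move=> AD /AD[u [_ <- um]]; rewrite -(submK um) mdegD leq_addl.
Qed.

Lemma upclosedD A m m' : upclosed A -> A m -> A (m + m')%MM.
Proof.
move=> Aup Am; have [t et] : exists t, t = mdeg m' by eexists.
elim: t m' et => [|t IHt] m' em.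
  by move/esym/eqP: em; rewrite mdeg_eq0 => /eqP->; rewrite addm0.
have [|l wl] := @exists_var m'; first by rewrite -em.
rewrite -(subUK wl) addmA; apply/Aup/IHt.
by move: em; rewrite (mdeg_subU wl) => -[].
Qed.

Lemma upclosed_le A m m' : upclosed A -> A m -> (m <= m')%MM -> A m'.
Proof.
by move=> Aup Am le; rewrite -(submK le) addmC; apply: upclosedD.
Qed.

End Monomials.

Section MonomialChains.
Variables (K : fieldType) (n : nat).
Local Notation S := {mpoly K[n]}.
Local Notation any := (fun=> True).

(** Coefficients are unchanged by multiplication by a variable, since the monomials are carried by
    the multidegree. *)
Definition actK (j : 'I_n) : {additive K -> K} := idfun.

Lemma kbd_consK y s (z : koszul K (y :: s)) :
  kbd actK z = (kbd actK z.1 + z.2, - kbd actK z.2).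
Proof. by rewrite /= kmap_id. Qed.

(* [chain M i b z]: [z] is a Koszul chain of homological degree [i] and
   multidegree [b] with coefficients in the span of the monomials in [M]; the
   monomial [b - tau] at the face [tau] is left implicit. *)
Fixpoint chain (M : 'X_{1..n} -> Prop) (i : nat) (b : 'X_{1..n})
    (s : seq 'I_n) : koszul K s -> Prop :=
  match s with
  | [::] => fun c => if i is 0%N then c != 0 -> M b else c = 0
  | y :: s' => fun z =>
      chain M i b z.1 /\
      (if i is i'.+1 then
         if b y == 0%N then z.2 = 0 else chain M i' (b - U_(y))%MM z.2
       else z.2 = 0)
  end.

Lemma koszul_pair (y : 'I_n) s (z w : koszul K (y :: s)) :
  z.1 = w.1 -> z.2 = w.2 -> z = w.
Proof.
move: z w => /= z w e1 e2.
by rewrite (surjective_pairing z) e1 e2 -surjective_pairing.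
Qed.

Section Chain.
Variable M : 'X_{1..n} -> Prop.

Lemma chain0 i b s : chain M i b (0 : koszul K s).
Proof.
elim: s i b => [|y s IHs] [|i] b //=; first by rewrite eqxx.
by split=> //; case: ifP.
Qed.

Lemma chainD i b s (z w : koszul K s) :
  chain M i b z -> chain M i b w -> chain M i b (z + w).
Proof.
elim: s i b z w => [|y s IHs] [|i] b z w /=.
- by move=> hz hw zw; have [z0|/hz//] := eqVneq z 0;
    apply: hw; rewrite z0 add0r in zw.
- by move=> -> ->; rewrite addr0.
- by case=> z0 -> [w0 ->]; rewrite addr0; split=> //; apply: IHs.
- case=> z0 z1 [w0 w1]; split; first exact: IHs.
  by case: ifP z1 w1 => _ => [-> ->|]; [rewrite addr0|apply: IHs].
Qed.

Lemma chainN i b s (z : koszul K s) : chain M i b z -> chain M i b (- z).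
Proof.
elim: s i b z => [|y s IHs] [|i] b z /=.
- by rewrite oppr_eq0.
- by move=> ->; rewrite oppr0.
- by case=> z0 ->; rewrite oppr0; split=> //; apply: IHs.
- case=> z0 z1; split; first exact: IHs.
  by case: ifP z1 => _ => [->|]; [rewrite oppr0|apply: IHs].
Qed.

Lemma chain_eq0 e i b s (z : koszul K s) :
    (forall m, M m -> (e <= mdeg m)%N) -> (mdeg b < e + i)%N ->
  chain M i b z -> z = 0.
Proof.
move=> Me; elim: s i b z => [|y s IHs] [|i] b z //=.
- rewrite addn0 => be hz; apply/eqP; apply: contraLR be => /hz/Me.
  by rewrite -leqNgt.
- by move=> be [/IHs z0 z1]; apply: koszul_pair => //; apply: z0.
- move=> be [/IHs z0 z1]; apply: koszul_pair; first exact: z0.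
  case: eqP z1 => [_ -> //|/eqP by0 /IHs-> //].
  by move: be; rewrite (mdeg_subU by0) addnS.
Qed.

Hypothesis M_up : upclosed M.

(** This is multiplication by the variable [y], invisible on coefficients. *)
Lemma chain_up i (b : 'X_{1..n}) y s (z : koszul K s) :
  b y != 0%N -> chain M i (b - U_(y))%MM z -> chain M i b z.
Proof.
elim: s i b z => [|j s IHs] [|i] b z by0 //=.
- by move=> hz /hz/(M_up y); rewrite subUK.
- by case=> /(IHs _ _ _ by0).
- case=> /(IHs _ _ _ by0) z0 z1; split=> //; move: z1.
  rewrite mnmBE mnm1E; have [<-|yj] := eqVneq y j.
    rewrite (negPf by0); case: eqP => [_ ->|by1]; first exact: chain0.
    by apply: IHs; rewrite mnmBE mnm1E eqxx; apply/eqP.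
  rewrite subn0; case: ifP => // _; rewrite subUC; apply: IHs.
  by rewrite mnmBE mnm1E [j == y]eq_sym (negPf yj) subn0.
Qed.

End Chain.

(** Restores the implicit monomials. The truncated difference does no harm on a [chain], whose
    component at [y] is zero when [b y = 0]; [kcoef], the extraction of the part of multidegree [b],
    has to test this explicitly. *)
Fixpoint kmono (b : 'X_{1..n}) (s : seq 'I_n) :
    koszul K s -> koszul 'cV[S]_1 s :=
  match s with
  | [::] => fun c => const_mx (c *: 'X_[b])
  | y :: s' => fun z => (kmono b z.1, kmono (b - U_(y))%MM z.2)
  end.

Fixpoint kcoef (b : 'X_{1..n}) (s : seq 'I_n) :
    koszul 'cV[S]_1 s -> koszul K s :=
  match s with
  | [::] => fun v => (v 0 0)@_b
  | y :: s' => fun z =>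
      (kcoef b z.1, if b y == 0%N then 0 else kcoef (b - U_(y))%MM z.2)
  end.

Lemma kmono0 b s : kmono b (0 : koszul K s) = 0.
Proof.
elim: s b => [|y s IHs] b /=; last by rewrite !IHs.
by apply/matrixP => p q; rewrite !mxE scale0r.
Qed.

Lemma kmonoD b s : {morph @kmono b s : z w / z + w}.
Proof.
elim: s b => [|y s IHs] b z w /=; last by rewrite !IHs.
by apply/matrixP => p q; rewrite !mxE scalerDl.
Qed.

Lemma kmonoN b s (z : koszul K s) : kmono b (- z) = - kmono b z.
Proof. by apply: (addrI (kmono b z)); rewrite -kmonoD !subrr kmono0. Qed.

Lemma kcoefD b s : {morph @kcoef b s : z w / z + w}.
Proof.
elim: s b => [|y s IHs] b z w /=; first by rewrite mxE mcoeffD.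
apply: (@koszul_pair y) => /=; first by rewrite IHs.
by case: ifP => _; rewrite ?addr0 ?IHs.
Qed.

Lemma kcoef0 b s : kcoef b (0 : koszul _ s) = 0.
Proof. by apply: (addrI (kcoef b 0)); rewrite -kcoefD !addr0. Qed.

Lemma kcoefN b s (z : koszul _ s) : kcoef b (- z) = - kcoef b z.
Proof. by apply: (addrI (kcoef b z)); rewrite -kcoefD !subrr kcoef0. Qed.

Lemma kmono_act M i b y s (z : koszul K s) : chain M i b z ->
  kmap (@actX K n 1 y) (kmono b z) = kmono (b + U_(y))%MM z.
Proof.
elim: s i b z => [|j s IHs] i b z /=.
  move=> _; apply/matrixP => p q; rewrite !mxE -scalerAr -mpolyXD.
  by rewrite addmC.
case=> /IHs-> z1; congr (_, _).
have [z10|[by0 z1M]] : z.2 = 0 \/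
    b j != 0%N /\ chain M i.-1 (b - U_(j))%MM z.2.
  by case: i z1 => [|i] /=; [left|case: eqP => [|/eqP]; [left|right]].
  by rewrite z10 !kmono0 kmap0.
rewrite (IHs _ _ _ z1M).
suff -> : (b - U_(j) + U_(y) = b + U_(y) - U_(j))%MM by [].
by apply/mnmP => l; rewrite !(mnmDE, mnmBE, mnm1E); case: (j =P l) => [<-|_];
  lia.
Qed.

Lemma kbd_mono M i b s (z : koszul K s) : chain M i b z ->
  kbd (@actX K n 1) (kmono b z) = kmono b (kbd actK z).
Proof.
elim: s i b z => [|y s IHs] i b z.
  by move=> _; apply/esym/(@kmono0 b [::]).
rewrite kbd_consK /=; case=> /IHs-> z1; rewrite kmonoD kmonoN.
have [z10|[by0 z1M]] : z.2 = 0 \/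
    b y != 0%N /\ chain M i.-1 (b - U_(y))%MM z.2.
  by case: i z1 => [|i] /=; [left|case: eqP => [|/eqP]; [left|right]].
  by rewrite z10 !(kmono0, kmap0, kbd0).
by rewrite (IHs _ _ _ z1M) (kmono_act _ z1M) subUK.
Qed.

Lemma kcoef_act b y s (z : koszul _ s) :
  kcoef b (kmap (@actX K n 1 y) z) =
  if b y == 0%N then 0 else kcoef (b - U_(y))%MM z.
Proof.
elim: s b z => [|j s IHs] b z /=; first by rewrite !mxE mcoeffXM.
rewrite !IHs !mnmBE !mnm1E; have [<-|yj] := eqVneq y j.
  by case: ifP.
rewrite /= !subn0 subUC.
by do 2!case: ifP.
Qed.

Lemma kbd_coef b s (z : koszul _ s) :
  kbd actK (kcoef b z) = kcoef b (kbd (@actX K n 1) z).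
Proof.
elim: s b z => [|y s IHs] b z; first by rewrite /= mxE mcoeff0.
rewrite kbd_consK /= IHs kcoefD kcoef_act; congr (_, _).
case: ifP => _; first by rewrite kbd0 oppr0.
by rewrite IHs kcoefN.
Qed.

Lemma kcoef_mono M i b s (z : koszul K s) :
  chain M i b z -> kcoef b (kmono b z) = z.
Proof.
elim: s i b z => [|y s IHs] i b z /=.
  by move=> _; rewrite mxE mcoeffZ mcoeffX eqxx mulr1.
case=> /IHs-> z1; rewrite [RHS]surjective_pairing; congr (_, _).
case: i z1 => [|i]; first by move=> ->; rewrite kmono0 kcoef0; case: ifP.
by case: ifP => [_ ->|_ /IHs].
Qed.

Lemma kdeg_mono M i b e s (z : koszul K s) : chain M i b z ->
    mdeg b = (e + i)%N ->
  kdeg (fun v : 'cV[S]_1 => (forall m, m \in msupp (v 0 0) -> M m) /\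
                            v 0 0 \is e.-homog) i (kmono b z).
Proof.
elim: s i b z => [|y s IHs] [|i] b z /=.
- move=> hz; rewrite addn0 => be; rewrite mxE; split=> [m|].
    have [->|/hz Mb] := eqVneq z 0; first by rewrite scale0r msupp0.
    by move/msuppZ_le; rewrite msuppX inE => /eqP->.
  by apply: dhomogZ; rewrite dhomogX /= be.
- by move=> -> _; apply/matrixP => p q; rewrite !mxE scale0r.
- by case=> z0 -> be; rewrite kmono0; split=> //; apply: IHs.
case=> z0 z1 be; split; first exact: IHs.
case: eqP z1 => [_ ->|/eqP by0 z1].
  rewrite kmono0; apply: kdeg0; rewrite mxE; split; last exact: dhomog0.
  by move=> m; rewrite msupp0.
apply: IHs z1 _; move: be; rewrite (mdeg_subU by0); lia.
Qed.

Lemma chain_coef (M : 'X_{1..n} -> Prop) i b s (z : koszul _ s) :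
    kdeg (fun v : 'cV[S]_1 => forall m, m \in msupp (v 0 0) -> M m) i z ->
  chain M i b (kcoef b z).
Proof.
elim: s i b z => [|y s IHs] [|i] b z /=.
- by move=> hz; rewrite -mcoeff_msupp; apply: hz.
- by move=> ->; rewrite mxE mcoeff0.
- by case=> z0 ->; rewrite kcoef0; split; [exact: IHs | case: ifP].
case=> z0 z1; split; first exact: IHs.
have [//|by0 /=] := boolP (b y == 0%N); exact: IHs.
Qed.

End MonomialChains.

(** * Koszul homology of an ideal with a linear resolution *)

Section LinearResolution.
Variables (K : fieldType) (n : nat).
Local Notation S := {mpoly K[n]}.
Local Notation any := (fun=> True).

Definition homcol r (e : nat) (v : 'cV[S]_r) : Prop :=
  forall q, v q 0 \is e.-homog.

Lemma homcol0 r e : homcol e (0 : 'cV[S]_r).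
Proof. by move=> q; rewrite mxE; exact: dhomog0. Qed.

Lemma homcolD r e (u v : 'cV[S]_r) : homcol e u -> homcol e v -> homcol e (u + v).
Proof. by move=> hu hv q; rewrite mxE; apply: dhomogD. Qed.

Lemma homcolN r e (u : 'cV[S]_r) : homcol e u -> homcol e (- u).
Proof. by move=> hu q; rewrite mxE rpredN. Qed.

Lemma homcolX r e j (u : 'cV[S]_r) : homcol e u -> homcol e.+1 (@actX K n r j u).
Proof.
move=> hu q; rewrite mxE -[e.+1]add1n; apply: dhomogM => //.
by rewrite dhomogX /= mdeg1.
Qed.

Lemma kbd_homcol r e i s (z : koszul 'cV[S]_r s) :
  kdeg (homcol e) i.+1 z -> kdeg (homcol e.+1) i (kbd (@actX K n r) z).
Proof.
elim: s i z => [|y s IHs] i z /=.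
  by move=> _; case: i => // q; exact: homcol0.
case=> /IHs z0 z1; split; last first.
  case: i z0 z1 => [|i] z0 z1; [rewrite (kbd_deg0 _ z1) oppr0 //|].
  by apply: kdegN => [u|]; [exact: homcolN | exact: IHs].
apply: kdegD => //; first by move=> u v; exact: homcolD.
by apply: kdeg_map z1 => v; exact: homcolX.
Qed.

Lemma kdeg_ker (V W : zmodType) (f : {additive V -> W}) (P : V -> Prop) i
    (s : seq 'I_n) (z : koszul V s) :
  kdeg P i z -> kmap f z = 0 -> kdeg (fun v => P v /\ f v = 0) i z.
Proof.
elim: s i z => [|y s IHs] [|i] z //=.
- by case=> z0 -> [e0 _]; split=> //; apply: IHs.
- by case=> z0 z1 [e0 e1]; split; apply: IHs.
Qed.

Lemma pihomogMl t e (b w : S) : b \is t.-homog ->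
  pihomog mdeg (t + e) (b * w) = b * pihomog mdeg e w.
Proof.
move=> hb; rewrite (mpolyE w) mulr_sumr !raddf_sum mulr_sumr.
apply: eq_bigr => m _; rewrite /= -scalerAr !linearZ /= pihomogX -scalerAr.
have hbm : b * 'X_[m] \is (t + mdeg m).-homog.
  by apply: dhomogM; rewrite ?dhomogX.
congr (_ *: _); have [em|em] := eqVneq (mdeg m) e.
  by rewrite pihomog_dE // -em.
by rewrite mulr0; apply: pihomog_ne0 hbm; rewrite eqn_add2l.
Qed.

(** The component of degree [e] of any preimage is again a preimage. *)
Lemma homcol_lift r0 r t e (B : 'M[S]_(r0, r)) v w :
    (forall p q, B p q \is t.-homog) -> homcol (t + e) v -> v = B *m w ->
  exists2 w', homcol e w' & B *m w' = v.
Proof.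
move=> hB hv ev; exists (\col_q pihomog mdeg e (w q 0)).
  by move=> q; rewrite mxE; exact: pihomogP.
apply/colP => p; rewrite -(pihomog_dE (hv p)) ev !mxE raddf_sum.
by apply: eq_bigr => q _; rewrite mxE /= pihomogMl.
Qed.

(** * Dimension shifting along a linear resolution *)

Section Resolution.
Variable s : seq 'I_n.
Hypotheses (s_uniq : uniq s) (s_full : forall j, j \in s).

(* Vanishing of the Koszul homology of the image of [A] in homological degree
   [i], outside the degree of its generators. *)
Definition koszul_linear r0 r (A : 'M[S]_(r0, r)) (i : nat) : Prop :=
  forall e (z : koszul 'cV[S]_r s), kdeg (@homcol r e.+1) i z ->
    kbd (@actX K n r0) (kmap (mulmx A) z) = 0 ->
  exists2 w : koszul 'cV[S]_r s, kdeg any i.+1 w &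
    kmap (mulmx A) (kbd (@actX K n r) w) = kmap (mulmx A) z.

(** Entries of positive degree lie in the ideal of all variables, so the column is a Koszul
    boundary. *)
Lemma koszul_linear0 r0 r (A : 'M[S]_(r0, r)) : koszul_linear A 0.
Proof.
move=> e z dz _; have [|w dw ew] := @varcol_boundary K n r s (kroot z).
  have {dz} : homcol e.+1 (kroot z).
    by elim: (s) z dz => [|y s' IHs] z //= [] /IHs.
  move=> hz q m /(dhomog_mf (hz q)) dm.
  have [|j mj] := @exists_var n m; first by rewrite dm.
  by apply/hasP; exists j.
exists w => //; congr kmap; apply: kroot_inj dz ew.
by apply: kbd_deg dw.
Qed.

(* Dimension shifting along 0 -> im B -> F -> im A -> 0. *)
Lemma koszul_linearS r0 r r1 (A : 'M[S]_(r0, r)) (B : 'M[S]_(r, r1)) i :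
    (forall v : 'cV[S]_r, A *m v = 0 <-> exists w, v = B *m w) ->
    (forall p q, B p q \is 1.-homog) ->
  koszul_linear B i -> koszul_linear A i.+1.
Proof.
move=> exAB hB linB e z dz ez.
have AB (v : 'cV_r1) : A *m (B *m v) = 0 by apply/exAB; exists v.
have kAB (v : koszul 'cV[S]_r1 s) : kmap (mulmx A) (kmap (mulmx B) v) = 0.
  by elim: (s) v => [|y s' IHs] v /=; rewrite ?AB ?IHs.
have bdA (v : koszul 'cV[S]_r s) : kbd (@actX K n r0) (kmap (mulmx A) v) =
    kmap (mulmx A) (kbd (@actX K n r) v).
  by apply: kbd_kmap => j u; exact: actX_mulmx.
have bdB (v : koszul 'cV[S]_r1 s) : kbd (@actX K n r) (kmap (mulmx B) v) =
    kmap (mulmx B) (kbd (@actX K n r1) v).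
  by apply: kbd_kmap => j u; exact: actX_mulmx.
(* [A] kills the boundary of [z], so this boundary lifts through [B]; as the entries of [B] are
   linear, the lift [x] has entries of degree [e.+1] again. *)
have [v [hv /exAB[w ew]]||x dx ex] :=
    kdeg_lift (f := mulmx B) (P := homcol e.+1) _
      (kdeg_ker (f := mulmx A) (kbd_homcol dz) _).
- have [|w' hw' ew'] := homcol_lift (t := 1) (e := e.+1) hB _ ew.
    by rewrite add1n.
  by exists w'.
- by rewrite -bdA.
have [|y dy ey] := linB e x dx.
  by rewrite ex (kbdK (@actXC K n r)).
(* [B y] has the same boundary as [z], so the difference is a cycle over a free module, and [A] does
   not see the correction [B y]. *)
have [||w dw ew] := @koszul_exact K n r s i (z - kmap (mulmx B) y) s_uniq.
- apply: kdegD => //; first exact: kdeg_sub dz.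
  by apply: kdegN => //; apply: kdeg_map dy.
- by rewrite kbdB bdB ey ex subrr.
exists w => //.
by rewrite ew kmapD kmapN kAB subr0.
Qed.

Variables (F : free_complex K n) (J : S -> Prop) (D : nat).
Hypotheses (F_graded : graded_complex F) (F_res : resolves F J).
Hypothesis F_linear : forall i (q : 'I_(rk F i)), shift q = (D + i)%N.

(** Each dimension shift lowers the Koszul degree by one and moves one step further along the
    resolution, hence an induction on [i] for all [j] at once. *)
Lemma diff_linear i j : koszul_linear (diff F j) i.
Proof.
elim: i j => [|i IHi] j; first exact: koszul_linear0.
apply: (koszul_linearS (B := diff F j.+1)) => //; last first.
  move=> p q; have := F_graded.2 j.+1 p q.
  by rewrite /homog_entry !F_linear !addnS ltnW // subSnn.
by case: F_res => _ _; apply.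
Qed.

Lemma aug_linear i : koszul_linear (aug F) i.
Proof.
case: i => [|i]; first exact: koszul_linear0.
apply: (koszul_linearS (B := diff F 0)); last exact: diff_linear.
  by case: F_res.
move=> p q; have := F_graded.2 0%N p q.
by rewrite /homog_entry !F_linear !addnS ltnW // subSnn.
Qed.

Variable M : 'X_{1..n} -> Prop.
Hypothesis J_monomial : forall f, J f <-> (forall m, m \in msupp f -> M m).
Hypothesis M_deg : forall m, M m -> (D <= mdeg m)%N.

(** Below total degree [D + i] there are no nonzero chains. Above it, the cycle lifts through
    [aug F] to a chain with entries of positive degree, where [aug_linear] applies. *)
Lemma linear_vanishing i b (z : koszul K s) :
    mdeg b != (D + i)%N -> chain M i b z -> kbd (@actK K n) z = 0 ->
  exists2 w, chain M i.+1 b w & kbd (@actK K n) w = z.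
Proof.
move=> bD cz ez; have [bl|bg] := ltnP (mdeg b) (D + i).
  by exists 0; [exact: chain0 | rewrite kbd0 (chain_eq0 M_deg bl cz)].
have {bD bg} [e be] : exists e, mdeg b = (D + e.+1 + i)%N.
  by exists (mdeg b - (D + i)).-1; move: bD bg; lia.
have dz := kdeg_mono cz be.
have [v [hv h]|x dx ex] := kdeg_lift (f := mulmx (aug F)) (P := homcol e.+1) _ dz.
  have [w ew] : exists w : 'cV[S]_(rk F 0), (aug F *m w) ord0 ord0 = v 0 0.
    by have [FJ _ _] := F_res; apply/FJ/J_monomial.
  have [|||w' hw' ew'] := @homcol_lift _ _ D e.+1 (aug F) v w.
  - move=> p q; have := F_graded.1 q.
    by rewrite /homog_entry F_linear addn0 subn0 (ord1 p).
  - by move=> q; rewrite (ord1 q).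
  - by apply/colP => p; rewrite (ord1 p) -ew.
  by exists w'.
have [|w dw ew] := aug_linear dx.
  by rewrite ex (kbd_mono cz) ez kmono0.
(* The bounding chain need not be multihomogeneous; its part of multidegree [b] suffices. *)
exists (kcoef b (kmap (mulmx (aug F)) w)).
  apply: chain_coef; apply: kdeg_map dw => v _.
  by apply/J_monomial; case: F_res => -> _ _; exists v.
rewrite kbd_coef.
have -> : kbd (@actX K n 1) (kmap (mulmx (aug F)) w) =
    kmap (mulmx (aug F)) (kbd (@actX K n (rk F 0)) w).
  by apply: kbd_kmap => j u; exact: actX_mulmx.
by rewrite ew ex (kcoef_mono cz).
Qed.

End Resolution.

End LinearResolution.

(** * Eliminating variables from the Koszul complex *)

Section Combinatorics.
Variables (K : fieldType) (n : nat) (M : 'X_{1..n} -> Prop).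
Local Notation bd := (kbd (@actK K n)).

(** Vanishing of the Koszul homology on [s] of the ideal spanned by [M], in homological degree [i]
    and multidegree [b]. *)
Definition vanish (i : nat) (b : 'X_{1..n}) (s : seq 'I_n) : Prop :=
  forall z : koszul K s, chain M i b z -> bd z = 0 ->
  exists2 w : koszul K s, chain M i.+1 b w & bd w = z.

Hypothesis M_up : upclosed M.

(** Vanishing over [y :: s] makes multiplication by [y] surjective on the homology over [s]. A class
    is thus divided by [y] repeatedly, until the exponent of [y] is exhausted. *)
Lemma vanish_down (P : 'X_{1..n} -> Prop) y s i :
    (forall b, P b -> b y != 0%N -> P (b - U_(y))%MM) ->
    (forall b, P b -> vanish i b (y :: s)) ->
  forall b, P b -> vanish i b s.
Proof.
move=> Py van b; have [k] := ubnP (mdeg b); elim: k b => // k IHk b bk Pb z cz ez.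
have [||[w0 w1]] := van b Pb (z, 0).
- by split=> //=; case: i {van IHk cz} => // i; case: ifP => // _; exact: chain0.
- by rewrite kbd_consK /= ez kbd0 addr0 oppr0.
case=> /= cw0 cw1; rewrite kmap_id => -[ew0 ew1].
have {ew1} ew1 : bd w1 = 0 by rewrite -[LHS]opprK ew1 oppr0.
case: eqP cw1 => [_ w10|/eqP by0 cw1].
  by exists w0 => //; rewrite -ew0 w10 addr0.
have [||x cx ex] := IHk (b - U_(y))%MM _ _ w1 cw1 ew1.
- by move: bk; rewrite (mdeg_subU by0).
- exact: Py.
exists (w0 + x); first by apply: chainD => //; apply: chain_up cx.
by rewrite kbdD ex.
Qed.

(** In the long exact sequence of the mapping cone, the homology over [y :: s] sits between these
    two groups over [s]. *)
Lemma vanish_up y s i b :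
    vanish i b s -> (forall i', i = i'.+1 -> b y != 0%N ->
      vanish i' (b - U_(y))%MM s) ->
  vanish i b (y :: s).
Proof.
move=> v0 v1 z [c0 c1]; rewrite kbd_consK => -[e0 e1].
have {e1} e1 : bd z.2 = 0 by rewrite -[LHS]opprK e1 oppr0.
have [z20|[i' [ei by0 c2]]] : z.2 = 0 \/ exists i', [/\ i = i'.+1, b y != 0%N &
    chain M i' (b - U_(y))%MM z.2].
- case: i c1 {v0 v1 c0} => [|i] /=; first by left.
  by case: eqP => [_|/eqP by0]; [left | right; exists i].
- have [|w cw ew] := v0 z.1 c0; first by rewrite -e0 z20 addr0.
  exists (w, 0); last first.
    rewrite kbd_consK /= ew addr0 kbd0 oppr0.
    by apply: (@koszul_pair K n y).
  by split=> //=; case: ifP => // _; exact: chain0.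
have [x cx ex] := v1 i' ei by0 z.2 c2 e1.
have [||w cw ew] := v0 (z.1 + x).
- by apply: chainD => //; rewrite ei; apply: chain_up cx.
- by rewrite kbdD ex.
exists (w, - x); last first.
  rewrite kbd_consK /= ew addrK kbdN opprK ex.
  exact: (@koszul_pair K n y).
by split=> //=; rewrite (negPf by0) ei; apply: chainN.
Qed.

Lemma vanish_down_cat (P : 'X_{1..n} -> Prop) t c i :
    (forall b y, y \in t -> P b -> b y != 0%N -> P (b - U_(y))%MM) ->
    (forall b, P b -> vanish i b (t ++ c)) ->
  forall b, P b -> vanish i b c.
Proof.
elim: t => [//|y t IHt] Pt van; apply: IHt.
  by move=> b j jt; apply: Pt; rewrite inE jt orbT.
by apply: (vanish_down (y := y)) => // b; apply: Pt; exact: mem_head.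
Qed.

(* Elementary form of the collapse of the spectral sequence
   H_p(t; H_q(c)) => H_(p+q)(t ++ c) on [P], where H_q(c) = 0 for q < i. *)
Lemma vanish_concentrated (P : 'X_{1..n} -> Prop) t c i E :
    (forall b y, y \in t -> P b -> b y != 0%N -> P (b - U_(y))%MM) ->
    (forall i', i = i'.+1 -> forall b, P b -> vanish i' b (t ++ c)) ->
    (forall b, P b -> mdeg b != E -> vanish i b (t ++ c)) ->
    (forall b, P b -> mdeg b = E -> vanish i b c) ->
  forall b, P b -> vanish i b c.
Proof.
move=> Pt vlow voff vE; apply: (vanish_down_cat Pt) => b Pb.
have [eb|] := eqVneq (mdeg b) E; last exact: voff.
(* In degree [E] the variables of [t] are added back one at a time. The lower homology that this
   involves vanishes by descent from the full list. *)
elim: t Pt vlow b Pb eb {voff} => [|y t IHt] Pt vlow b Pb eb; first exact: vE.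
have Pt' b' j : j \in t -> P b' -> b' j != 0%N -> P (b' - U_(j))%MM.
  by move=> jt; apply: Pt; rewrite inE jt orbT.
have Py b' : P b' -> b' y != 0%N -> P (b' - U_(y))%MM.
  by apply: Pt; exact: mem_head.
have vlow' i' : i = i'.+1 -> forall b, P b -> vanish i' b (t ++ c).
  by move=> ei; apply: (vanish_down (y := y)) => //; apply: vlow.
apply: vanish_up; first exact: IHt.
by move=> i' ei by0; apply: vlow' => //; apply: Py.
Qed.

(** * Koszul homology in degree one and connectedness *)

Section Connected.

Fixpoint kvert (i : 'I_n) (s : seq 'I_n) : koszul K s :=
  match s with
  | [::] => 0
  | y :: s' => if y == i then (0, kconst (1 : K) s') else (kvert i s', 0)
  end.

(** Pairing of the part of homological degree 1 with a function on the variables. *)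
Fixpoint kev (g : 'I_n -> K) (s : seq 'I_n) : koszul K s -> K :=
  match s with
  | [::] => fun=> 0
  | y :: s' => fun z => kev g z.1 + g y * kroot z.2
  end.

Lemma kroot0 (s : seq 'I_n) : kroot (0 : koszul K s) = 0.
Proof. by elim: s. Qed.

Lemma krootN (s : seq 'I_n) (z : koszul K s) : kroot (- z) = - kroot z.
Proof. by elim: s z => [|y s IHs] z //=. Qed.

Lemma kevD g s (z w : koszul K s) : kev g (z + w) = kev g z + kev g w.
Proof.
elim: s z w => [|y s IHs] z w /=; first by rewrite addr0.
by rewrite IHs krootD mulrDr addrACA.
Qed.

Lemma kev0 g s : kev g (0 : koszul K s) = 0.
Proof. by elim: s => [|y s IHs] //=; rewrite IHs kroot0 mulr0 addr0. Qed.

Lemma kevN g s (z : koszul K s) : kev g (- z) = - kev g z.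
Proof. by apply: (addrI (kev g z)); rewrite -kevD !subrr kev0. Qed.

Lemma kev_vert g i s : i \in s -> kev g (kvert i s) = g i.
Proof.
elim: s => [//|y s IHs]; rewrite inE eq_sym /=; case: eqP => [<- _|_ /= /IHs e] /=.
  by rewrite kev0 kroot_const mulr1 add0r.
by rewrite e kroot0 mulr0 addr0.
Qed.

Lemma chain_const b c s : M b -> chain M 0 b (kconst (c : K) s).
Proof. by move=> Mb; elim: s. Qed.

Lemma kbd_vert i s : i \in s -> bd (kvert i s) = kconst 1 s.
Proof.
elim: s => [//|y s IHs]; rewrite inE eq_sym kbd_consK /=.
case: eqP => [_ _|_ /= /IHs e] /=.
  by rewrite kbd0 add0r (kbd_deg0 _ (@kdeg_const n K (fun=> True) 1 s I)) oppr0.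
by rewrite e kbd0 oppr0 addr0.
Qed.

Lemma chain_vert i (b : 'X_{1..n}) s : b i != 0%N -> M (b - U_(i))%MM ->
  chain M 1 b (kvert i s).
Proof.
move=> bi Mb; elim: s => [//|y s IHs] /=; case: eqP => [->|_] /=; split=> //.
- exact: chain0.
- by rewrite (negPf bi); apply: chain_const.
- by case: ifP => // _; exact: chain0.
Qed.

Lemma chain_root b s (z : koszul K s) : chain M 0 b z -> kroot z != 0 -> M b.
Proof. by elim: s z => [|y s IHs] z //= [/IHs]. Qed.

Lemma kroot_bd s (z : koszul K s) : kroot (bd z) = kev (fun=> 1) z.
Proof.
elim: s z => [|y s IHs] z //.
by rewrite kbd_consK /= krootD IHs mul1r.
Qed.

Lemma kev_constant g a (b : 'X_{1..n}) s (z : koszul K s) : chain M 1 b z ->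
    (forall j, b j != 0%N -> M (b - U_(j))%MM -> g j = a) ->
  kev g z = a * kev (fun=> 1) z.
Proof.
move=> + ga; elim: s z => [|y s IHs] z /=; first by rewrite mulr0.
case=> /IHs-> z1; rewrite mulrDr mul1r; congr (_ + _).
case: eqP z1 => [_ ->|/eqP by0 /chain_root Mz]; first by rewrite kroot0 !mulr0.
have [->|/Mz/(ga y by0)->//] := eqVneq (kroot z.2) 0.
by rewrite !mulr0.
Qed.

(** The boundary of the face on [k] and [l] evaluates, up to sign, to [g k - g l]. *)
Lemma kev_bd g (b : 'X_{1..n}) s (z : koszul K s) : chain M 2 b z ->
    (forall k l, b k != 0%N -> (b - U_(k))%MM l != 0%N ->
       M (b - U_(k) - U_(l))%MM -> g k = g l) ->
  kev g (bd z) = 0.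
Proof.
move=> + gE; elim: s z => [|y s IHs] z //; rewrite kbd_consK /=.
case=> /IHs e z1; rewrite kevD e add0r krootN kroot_bd.
case: eqP z1 => [_ ->|/eqP by0 c1]; first by rewrite !kev0 oppr0 mulr0 addr0.
rewrite (kev_constant (a := g y) c1) ?mulrN ?subrr // => l bl Ml.
by apply/esym/gE.
Qed.

(* A function that is constant along the edges of the complex kills boundaries,
   hence takes equal values at two vertices with homologous classes. *)
Lemma connected_constant (b : 'X_{1..n}) s (g : 'I_n -> K) i j : vanish 1 b s ->
    i \in s -> j \in s ->
    b i != 0%N -> M (b - U_(i))%MM -> b j != 0%N -> M (b - U_(j))%MM ->
    (forall k l, b k != 0%N -> (b - U_(k))%MM l != 0%N ->
       M (b - U_(k) - U_(l))%MM -> g k = g l) ->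
  g i = g j.
Proof.
move=> van si sj bi Mi bj Mj gE.
have [||w cw ew] := van (kvert i s - kvert j s).
- by apply: chainD; [|apply: chainN]; apply: chain_vert.
- by rewrite kbdB !kbd_vert // subrr.
have := kev_bd cw gE; rewrite ew kevD kevN !kev_vert // => /eqP.
by rewrite subr_eq0 => /eqP.
Qed.

End Connected.

(** * Top-dimensional chains and socle monomials *)

Section Top.

Fixpoint ktop (c : K) (s : seq 'I_n) : koszul K s :=
  match s with [::] => c | y :: s' => (0, ktop c s') end.

Definition ones (s : seq 'I_n) : 'X_{1..n} := (\sum_(j <- s) U_(j))%MM.

Lemma ones_cons y s : ones (y :: s) = (U_(y) + ones s)%MM.
Proof. exact: big_cons. Qed.

Lemma ktop0 s : ktop 0 s = 0.
Proof. by elim: s => [|y s IHs] //=; rewrite IHs. Qed.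

Lemma ktop_eq0 c s : ktop c s = 0 -> c = 0.
Proof. by elim: s => [|y s IHs] //= [/IHs]. Qed.

Lemma chain_size i b s (z : koszul K s) :
  (size s < i)%N -> chain M i b z -> z = 0.
Proof.
elim: s i b z => [|y s IHs] [|i] b z //= si [/IHs z0 z1].
apply: (@koszul_pair K n y); first by apply: z0; exact: ltnW.
by case: ifP z1 => // _; apply: IHs.
Qed.

Lemma chain_top b s (z : koszul K s) :
  chain M (size s) b z -> exists c, z = ktop c s.
Proof.
elim: s b z => [|y s IHs] b z /=; first by exists z.
case=> /(chain_size (ltnSn _)) z0 z1.
have [c ec] : exists c, z.2 = ktop c s.
  by case: ifP z1 => [_ ->|_ /IHs//]; exists 0; rewrite ktop0.
by exists c; apply: (@koszul_pair K n y).
Qed.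

Lemma addones_cons u y s : (u + ones (y :: s) - U_(y))%MM = (u + ones s)%MM.
Proof. by apply/mnmP => j; rewrite ones_cons mnmBE !mnmDE; lia. Qed.

Lemma addones_neq0 u y s : (u + ones (y :: s))%MM y == 0%N = false.
Proof. by rewrite ones_cons !mnmDE mnm1E eqxx addnCA. Qed.

Lemma chain_topP u c s :
  chain M (size s) (u + ones s)%MM (ktop c s) <-> (c != 0 -> M u).
Proof.
elim: s => [|y s IHs] /=.
  by rewrite /ones big_nil addm0.
rewrite addones_neq0 addones_cons; split=> [[_ /IHs]//|h].
by split; [exact: chain0 | apply/IHs].
Qed.

Lemma kbd_top_cons c y s :
  bd (ktop c (y :: s)) = (ktop c s, - bd (ktop c s)).
Proof. by rewrite kbd_consK /= kbd0 add0r. Qed.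

(** The face omitting [i] carries the monomial [u + U_(i)], with coefficient [c] up to sign. *)
Lemma chain_bd_topP u c s : c != 0 ->
  chain M (size s).-1 (u + ones s)%MM (bd (ktop c s)) <->
  (forall i, i \in s -> M (u + U_(i))%MM).
Proof.
move=> c0; elim: s => [|y s IHs]; first by split=> // _; exact: chain0.
rewrite kbd_top_cons /= addones_neq0 addones_cons.
have -> : (u + ones (y :: s) = (u + U_(y)) + ones s)%MM.
  by rewrite ones_cons addmA.
split=> [[/chain_topP/(_ c0) My c1] i|Ms].
  rewrite inE => /orP[/eqP->//|]; apply/IHs: i.
  case es: (size s) c1 => [|k] c1.
    by rewrite (size0nil es) /=; rewrite eqxx.
  by rewrite /= -[bd _]opprK; apply: chainN.
split; first by apply/chain_topP => _; apply: Ms; exact: mem_head.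
have /IHs : forall i, i \in s -> M (u + U_(i))%MM.
  by move=> i si; apply: Ms; rewrite inE si orbT.
case es: (size s) => [|k] c1; first by rewrite (size0nil es) /= oppr0.
exact: chainN.
Qed.

(** The face omitting the first variable supplies [c], and the cycle condition determines all other
    coefficients. *)
Lemma cycle_top b s (z : koszul K s) : (0 < size s)%N ->
    chain M (size s).-1 b z -> bd z = 0 ->
  exists c, z = bd (ktop c s).
Proof.
case: s z => [//|y s] z _ [/chain_top[c ec] _].
rewrite kbd_consK => -[e0 _]; exists c; rewrite kbd_top_cons.
apply: (@koszul_pair K n y) => //=.
by apply/eqP; rewrite -addr_eq0 addrC -ec e0.
Qed.

End Top.

End Combinatorics.

(** * Monomial ideals with linear Koszul homology *)

Section LinearMonomials.
Variables (K : fieldType) (n : nat) (M : 'X_{1..n} -> Prop) (D : nat).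
Hypothesis M_up : upclosed M.
Hypothesis M_gen : generated_in M D.

(** Multigraded form of a linear resolution: the Koszul homology on all variables is concentrated in
    total degree [D + i]. *)
Definition linear_monomials : Prop := forall (s : seq 'I_n) i b,
  uniq s -> (forall j, j \in s) -> mdeg b != (D + i)%N -> vanish K M i b s.

Hypothesis M_linear : linear_monomials.

Definition wt (C : {set 'I_n}) (m : 'X_{1..n}) : nat := (\sum_(i in C) m i)%N.

Lemma wtD C m1 m2 : wt C (m1 + m2) = (wt C m1 + wt C m2)%N.
Proof.
by rewrite /wt -big_split /=; apply: eq_bigr => i _; rewrite mnmDE.
Qed.

Lemma wtU C j : wt C U_(j) = (j \in C).
Proof.
rewrite /wt (eq_bigr (fun i => (j == i) : nat)); last by move=> i _; rewrite mnm1E.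
case jC: (j \in C); last first.
  by rewrite big1 // => i iC; case: eqP => // ji; rewrite ji iC in jC.
rewrite (bigD1 j jC) /= eqxx big1 ?addn0 // => i /andP[_].
by rewrite eq_sym => /negPf->.
Qed.

Lemma leq_wt C m : (wt C m <= mdeg m)%N.
Proof.
by rewrite mdegE [X in (_ <= X)%N](bigID (mem C)) /= leq_addr.
Qed.

Lemma mdeg_ones (s : seq 'I_n) : mdeg (ones s) = size s.
Proof.
elim: s => [|y s IHs]; first by rewrite /ones big_nil mdeg0.
by rewrite ones_cons mdegD mdeg1 IHs.
Qed.

Lemma ones_count (s : seq 'I_n) j : ones s j = count_mem j s.
Proof.
elim: s => [|y s IHs]; first by rewrite /ones big_nil mnm0E.
by rewrite ones_cons mnmDE mnm1E IHs.
Qed.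

Lemma wt_ones (C : {set 'I_n}) (s : seq 'I_n) :
  {subset s <= C} -> wt C (ones s) = size s.
Proof.
elim: s => [|y s IHs] sC.
  by rewrite /ones big_nil /wt big1 // => i _; rewrite mnm0E.
rewrite ones_cons wtD wtU sC ?mem_head // IHs // => j js.
by apply: sC; rewrite inE js orbT.
Qed.

Lemma chain_empty i b s (z : koszul K s) :
  (forall m, (m <= b)%MM -> ~ M m) -> chain M i b z -> z = 0.
Proof.
elim: s i b z => [|y s IHs] [|i] b z Mb //=.
- have [//|z0 /(_ isT) Mbb] := eqVneq z 0.
  by case: (Mb b) => //; exact: lepm_refl.
- by case=> /(IHs _ _ _ Mb) z0 z1; apply: (@koszul_pair K n y).
case=> /(IHs _ _ _ Mb) z0 z1; apply: (@koszul_pair K n y) => //.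
case: ifP z1 => // _; apply: IHs => m mb; apply: Mb.
exact: lepm_trans mb (lem_subr _ _).
Qed.

(** * Constancy of the C-degree on the generators *)

Section Closed.
Variables (C : {set 'I_n}).

Hypothesis C_closed : forall v i j, (mdeg v).+1 = D ->
  M (v + U_(i))%MM -> M (v + U_(j))%MM -> (i \in C) = (j \in C).

(* All generators below a multidegree [b] have the same weight, by induction on
   [mdeg b]: for [mdeg b > D + 1] the homology vanishing connects the
   multidegrees [b - U_(i)]. *)
Lemma gen_wt u u' : M u -> mdeg u = D -> M u' -> mdeg u' = D -> wt C u = wt C u'.
Proof.
move=> Mu du Mu' du'.
have [b ub u'b] : exists2 b, (u <= b)%MM & (u' <= b)%MM.
  by exists (u + u')%MM; [exact: lem_addr | exact: lem_addl].
have [k] := ubnP (mdeg b); elim: k b u u' Mu du Mu' du' ub u'b => // k IHk.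
move=> b u u' Mu du Mu' du' ub u'b bk.
have mle (x : 'X_{1..n}) : (x <= b)%MM -> (mdeg x <= mdeg b)%N.
  by move/mnm_lepP => xb; rewrite !mdegE leq_sum.
have [bD|bD] := leqP (mdeg b) D.
  have eqb (x : 'X_{1..n}) : (x <= b)%MM -> mdeg x = D -> x = b.
    move=> xb dx; apply/mnmP => j; apply/eqP; rewrite eqn_leq (mnm_lepP xb) /=.
    rewrite leqNgt; apply/negP => xbj.
    have : (mdeg x < mdeg b)%N.
      rewrite !mdegE (bigD1 j) // [X in (_ < X)%N](bigD1 j) //=.
      rewrite -addSn leq_add //; apply: leq_sum => i _; exact: (mnm_lepP xb).
    by rewrite dx ltnNge bD.
  by rewrite (eqb u) // (eqb u').
have [i bi ui] : exists2 i, b i != 0%N & (u <= b - U_(i))%MM.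
  by apply: exists_lt_mnm; rewrite ?du.
have [j bj uj] : exists2 j, b j != 0%N & (u' <= b - U_(j))%MM.
  by apply: exists_lt_mnm; rewrite ?du'.
have below l x y : b l != 0%N -> M x -> mdeg x = D -> M y -> mdeg y = D ->
    (x <= b - U_(l))%MM -> (y <= b - U_(l))%MM -> wt C x = wt C y.
  move=> bl Mx dx My dy xl yl; apply: (IHk (b - U_(l))%MM) => //.
  by move: bk; rewrite (mdeg_subU bl).
(* In degree [D + 1] the two generators are [b - U_(i)] and [b - U_(j)], so a single linear relation
   links them. *)
have sq : (b - U_(i) != b - U_(j))%MM -> mdeg b = D.+1 -> wt C u = wt C u'.
  move=> nij bD1.
  have eqx l x : b l != 0%N -> mdeg x = D -> (x <= b - U_(l))%MM ->
      x = (b - U_(l))%MM.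
    move=> bl dx xl; have := submK xl.
    have : mdeg (b - U_(l) - x) = 0%N.
      have := congr1 mdeg (submK xl); rewrite mdegD; have := mdeg_subU bl; lia.
    by move/eqP; rewrite mdeg_eq0 => /eqP->; rewrite add0m.
  have eu := eqx i u bi du ui; have eu' := eqx j u' bj du' uj.
  have bji : (b - U_(i))%MM j != 0%N.
    rewrite mnmBE mnm1E; case: (i =P j) => [eij|_]; last by rewrite subn0.
    by rewrite eij eqxx in nij.
  have e1 : u = (b - U_(i) - U_(j) + U_(j))%MM by rewrite subUK.
  have bij : (b - U_(j))%MM i != 0%N.
    move: bji; rewrite !mnmBE !mnm1E; case: (i =P j) => [->|/eqP nij'].
      by rewrite eqxx.
    by rewrite [j == i]eq_sym (negPf nij') !subn0.
  have e2 : u' = (b - U_(i) - U_(j) + U_(i))%MM by rewrite subUC subUK.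
  rewrite e1 e2 !wtD !wtU; congr (_ + _)%N; congr nat_of_bool.
  apply: (C_closed (v := (b - U_(i) - U_(j))%MM)).
  - have := mdeg_subU bji; have := mdeg_subU bi; lia.
  - by rewrite -e1.
  - by rewrite -e2.
have [bD1|bD1] := eqVneq (mdeg b) D.+1.
  have [eij|/sq->//] := eqVneq (b - U_(i))%MM (b - U_(j))%MM.
  by apply: (below i) => //; rewrite eij.
(* [g] is the indicator of the vertices [l] such that some generator below [b - U_(l)] has the
   weight of [u]. *)
pose P l x := (wt C x = wt C u) /\ [/\ M x, mdeg x = D & (x <= b - U_(l))%MM].
have [g gP] : exists g : 'I_n -> K, forall l,
    (g l = 1 /\ exists x, P l x) \/ (g l = 0 /\ ~ exists x, P l x).
  apply: (@fin_all_exists _ (fun=> K) (fun l c => (c = 1 /\ exists x, P l x) \/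
    (c = 0 /\ ~ exists x, P l x))) => l.
  by have [Pl|Pl] := Classical_Prop.classic (exists x, P l x);
    [exists 1; left | exists 0; right].
(* A generator below [b - U_(l) - U_(l')] lies below both vertices, and by induction all generators
   below one vertex share their weight. *)
have gE l l' : b l != 0%N -> (b - U_(l))%MM l' != 0%N ->
    M (b - U_(l) - U_(l'))%MM -> g l = g l'.
  move=> bl bl' /M_gen[x [Mx dx xb]].
  have xl : (x <= b - U_(l))%MM by apply: lepm_trans xb (lem_subr _ _).
  have xl' : (x <= b - U_(l'))%MM.
    by apply: lepm_trans (lem_subr _ U_(l)); rewrite subUC.
  have bl'0 : b l' != 0%N.
    by apply: contraNneq bl'; rewrite mnmBE => ->; rewrite sub0n.
  case: (gP l) => -[-> h]; case: (gP l') => -[-> h'] //; [case: h'|case: h].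
    case: h => y [wy [My dy yl]]; exists x; split; last by split.
    by rewrite -wy; apply: (below l).
  case: h' => y [wy [My dy yl]]; exists x; split; last by split.
  by rewrite -wy; apply: (below l').
have van : vanish K M 1 b (enum 'I_n).
  by apply: M_linear; rewrite ?enum_uniq ?addn1 // => l; rewrite mem_enum.
have := connected_constant van (mem_enum 'I_n i) (mem_enum 'I_n j)
  bi (upclosed_le M_up Mu ui) bj (upclosed_le M_up Mu' uj) gE.
case: (gP i) => -[-> h]; last by case: h; exists u.
case: (gP j) => -[-> h']; last by move/eqP; rewrite oner_eq0.
by case: h' => y [<- [My dy yl]] _; apply: (below j).
Qed.

End Closed.

(** * A socle monomial of degree [D - 1] *)

Section Witness.
Variables (C : {set 'I_n}) (c : nat).
Hypothesis C_wt : forall m, M m -> mdeg m = D -> wt C m = c.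

(** A generator dividing [m] contributes [c] to the degree in [C] and [D - c] to the degree outside
    [C]. *)
Lemma M_wt m : M m -> (c <= wt C m)%N /\ (D + wt C m <= mdeg m + c)%N.
Proof.
case/M_gen => x [Mx dx xm]; rewrite -(submK xm) wtD mdegD (C_wt Mx dx) dx.
by have := leq_wt C (m - x)%MM; lia.
Qed.

Variable u : 'X_{1..n}.
Hypothesis C_neq0 : C != set0.
Hypothesis u_notin : ~ M u.
Hypothesis u_socle : forall i, i \in C -> M (u + U_(i))%MM.

Lemma linear_witness :
  exists v, [/\ (mdeg v).+1 = D, (wt C v).+1 = c &
    forall i, i \in C -> M (v + U_(i))%MM].
Proof.
apply: Classical_Prop.NNPP => nov.
pose s := enum C; pose t := enum (~: C).
have szs : size s = #|C| by rewrite /s -cardE.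
have h0 : (0 < size s)%N by rewrite szs card_gt0.
have ts_uniq : uniq (t ++ s).
  rewrite cat_uniq !enum_uniq andbT /=; apply/hasPn => j.
  by rewrite !mem_enum inE negbK.
have ts_full j : j \in t ++ s by rewrite mem_cat !mem_enum inE orNb.
have sC : {subset s <= C} by move=> j; rewrite mem_enum.
(* The multidegrees of the form [v + ones s] with [v] of the same C-degree as [u]. *)
pose P (b : 'X_{1..n}) := (forall j, j \in C -> b j != 0%N) /\
  wt C b = (wt C u + size s)%N.
have [i0 i0C] := set0Pn _ C_neq0.
have cu : (c <= (wt C u).+1)%N.
  by have [] := M_wt (u_socle i0C); rewrite wtD wtU i0C addn1.
have Pt b y : y \in t -> P b -> b y != 0%N -> P (b - U_(y))%MM.
  rewrite mem_enum inE => yC [bC wb] by0; split.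
    move=> j jC; rewrite mnmBE mnm1E; case: (y =P j) => [yj|_].
      by rewrite yj jC in yC.
    by rewrite subn0 bC.
  by rewrite -wb -{2}(subUK by0) wtD wtU (negPf yC) addn0.
have Pu : P (u + ones s)%MM.
  split; last by rewrite wtD wt_ones.
  move=> j jC; rewrite mnmDE /ones mnm_sumE addn_eq0 negb_and; apply/orP; right.
  by rewrite (big_rem j) ?mem_enum //= mnm1E eqxx.
(* Homology of the ideal in degree [h - 1], with [h] the size of [C], is homology of the quotient in
   degree [h]. If it vanished at [u + ones s], the boundary of the top face would bound a top chain
   with coefficient monomial [u], which is not in [M]. *)
suff van b : P b -> vanish K M (size s).-1 b s.
  have [||w] := van _ Pu (kbd (@actK K n) (ktop 1 s)).
  - by apply/chain_bd_topP; rewrite ?oner_neq0 // => i /sC; exact: u_socle.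
  - by rewrite kbdK.
  rewrite prednK // => cw; have [a ea] := chain_top cw.
  move: cw; rewrite ea => /chain_topP; have [->|_ /(_ isT)//] := eqVneq a 0.
  move=> _; rewrite ktop0 kbd0; case: (s) h0 => [//|y s'] _.
  rewrite kbd_top_cons => -[/esym/ktop_eq0/eqP].
  by rewrite oner_eq0.
apply: (vanish_concentrated M_up (E := (D + (size s).-1)%N) Pt).
(* Here [h = i + 2] and the C-degree of [b'] is at least [c + i + 1]. In total degree [D + i] this
   leaves less than [D - c] outside [C], so no monomial of [M] divides [b']. *)
- move=> i ei b' [bC wb]; have [bD|] := eqVneq (mdeg b') (D + i)%N; last first.
    exact: M_linear.
  move=> z cz _; exists 0; first exact: chain0.
  rewrite kbd0 (chain_empty _ cz) // => m mb /M_wt[_ hm].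
  have := leq_wt C (b' - m)%MM.
  have := congr1 mdeg (submK mb); have := congr1 (wt C) (submK mb).
  rewrite wtD mdegD; lia.
- by move=> b' _; apply: M_linear.
(* In total degree [D + h - 1] a nonzero cycle is the boundary of a top face, and [b' - ones s]
   would be the excluded witness. *)
move=> b' [bC wb] bD z cz ez; have [a ea] := cycle_top h0 cz ez.
exists 0; first exact: chain0.
rewrite kbd0 ea; have [->|a0] := eqVneq a 0; first by rewrite ktop0 kbd0.
case: nov; exists (b' - ones s)%MM.
have onesE j : ones s j = (j \in C).
  by rewrite ones_count (count_uniq_mem _ (enum_uniq _)) mem_enum.
have eb : b' = (b' - ones s + ones s)%MM.
  by rewrite submK //; apply/mnm_lepP => j; rewrite onesE;
    case jC: (j \in C); rewrite // lt0n bC.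
have Mv i : i \in C -> M (b' - ones s + U_(i))%MM.
  move=> iC; move: cz; rewrite {1}eb ea => /(chain_bd_topP _ _ _ a0); apply.
  by rewrite mem_enum.
have := congr1 mdeg eb; have := congr1 (wt C) eb.
rewrite wtD wt_ones // mdegD mdeg_ones bD => ew ed.
(* The two bounds together force the C-degree to be exactly [c - 1]. *)
have [] := M_wt (Mv i0 i0C); rewrite wtD wtU i0C mdegD mdeg1 /= => w1 w2.
split; last exact: Mv; move: h0 ed w1 w2;
  by move: (mdeg _) (size s) (wt _ _) => p q r; lia.
Qed.

End Witness.

End LinearMonomials.

(** * Powers and associated primes of monomial ideals *)

Section MonomialIdeals.
Variables (K : fieldType) (n : nat).
Local Notation S := {mpoly K[n]}.
Implicit Types (A B : 'X_{1..n} -> Prop).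

Definition monideal A (f : S) : Prop := forall m, m \in msupp f -> A m.

Lemma monidealX A m : monideal A ('X_[m] : S) <-> A m.
Proof.
split=> [|Am m']; first by apply; rewrite msuppX mem_head.
by rewrite msuppX inE => /eqP->.
Qed.

Lemma monideal0 A : monideal A 0.
Proof. by move=> m; rewrite msupp0. Qed.

Lemma monidealD A f g : monideal A f -> monideal A g -> monideal A (f + g).
Proof.
by move=> hf hg m /msuppD_le; rewrite mem_cat => /orP[]; [exact: hf|exact: hg].
Qed.

Lemma monidealM A B f g : monideal A f -> monideal B g ->
  monideal (fun m => exists a b, [/\ A a, B b & m = (a + b)%MM]) (f * g).
Proof.
move=> hf hg m /msuppM_le/allpairsP[[a b] /= [/hf Aa /hg Bb ->]].
by exists a, b.
Qed.

Lemma monidealMl A r f : upclosed A -> monideal A f -> monideal A (r * f).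
Proof.
move=> Aup hf m /msuppM_le/allpairsP[[a b] /= [_ /hf Ab ->]].
by rewrite addmC; apply: upclosedD.
Qed.

Lemma ideal_gen0 (G : S -> Prop) : ideal_gen G 0.
Proof. by exists 0%N, (fun=> 0), (fun=> 0); split=> [[]|]; rewrite ?big_ord0. Qed.

Lemma ideal_genD (G : S -> Prop) f g :
  ideal_gen G f -> ideal_gen G g -> ideal_gen G (f + g).
Proof.
case=> m1 [c1 [g1 [G1 ->]]] [m2 [c2 [g2 [G2 ->]]]].
exists (m1 + m2)%N, (fun i => match split i with inl j => c1 j | inr j => c2 j end),
  (fun i => match split i with inl j => g1 j | inr j => g2 j end); split.
  by move=> i; case: (split i).
rewrite big_split_ord; congr (_ + _); apply: eq_bigr => i _.
  by have := unsplitK (inl i : 'I_m1 + 'I_m2)%type; rewrite /= => ->.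
by have := unsplitK (inr i : 'I_m1 + 'I_m2)%type; rewrite /= => ->.
Qed.

Lemma ideal_gen_mem (G : S -> Prop) r g : G g -> ideal_gen G (r * g).
Proof.
by move=> Gg; exists 1%N, (fun=> r), (fun=> g); split=> //; rewrite big_ord1.
Qed.

Lemma monideal_gen A (G : S -> Prop) f :
    (forall m, A m -> exists r g, G g /\ 'X_[m] = r * g) ->
  monideal A f -> ideal_gen G f.
Proof.
move=> AG hf; rewrite (mpolyE f) big_seq.
apply: (big_ind (ideal_gen G)); [exact: ideal_gen0|exact: ideal_genD|].
move=> m /hf/AG[r [g [Gg ->]]]; rewrite scalerAl; exact: ideal_gen_mem.
Qed.

Lemma gen_monideal A (G : S -> Prop) f : upclosed A ->
  (forall g, G g -> monideal A g) -> ideal_gen G f -> monideal A f.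
Proof.
move=> Aup GA [m [c [g [Gg ->]]]].
apply: (@big_ind _ (monideal A)).
- exact: monideal0.
- exact: monidealD.
by move=> i _; apply: monidealMl Aup _; apply: GA.
Qed.

Fixpoint mpow A (k : nat) (m : 'X_{1..n}) : Prop :=
  if k is k'.+1 then exists a b, [/\ A a, mpow A k' b & m = (a + b)%MM]
  else True.

Lemma mpow_up A k : upclosed A -> upclosed (mpow A k).
Proof.
move=> Aup; case: k => [//|k] _ j [a [b [Aa Ab ->]]].
exists (a + U_(j))%MM, b; split=> //; first exact: Aup.
by rewrite -!addmA [(b + _)%MM]addmC.
Qed.

Lemma mpow_gen A d k : generated_in A d -> generated_in (mpow A k) (d * k).
Proof.
move=> Ad; elim: k => [|k IHk] m.
  move=> _; exists 0%MM; rewrite mdeg0 muln0.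
    by split=> //; apply/mnm_lepP => j; rewrite mnm0E.
case=> a [b [/Ad[u [Au du ua]] /IHk[w [Mw dw wb]] ->]].
exists (u + w)%MM; split; first by exists u, w.
  by rewrite mdegD du dw mulnS.
apply/mnm_lepP => j; rewrite !mnmDE.
by rewrite leq_add // ?(mnm_lepP ua) ?(mnm_lepP wb).
Qed.

Lemma mpow_add A k l m : upclosed A ->
  mpow A (k + l) m <-> exists a b, [/\ mpow A k a, mpow A l b & m = (a + b)%MM].
Proof.
move=> Aup; elim: k m => [|k IHk] m.
  split=> [Am|[a [b [_ Ab ->]]]]; first by exists 0%MM, m; rewrite add0m.
  by rewrite addmC; apply: upclosedD => //; apply: mpow_up.
split=> [[a [b [Aa /IHk[a' [b' [Aa' Ab' ->]]] ->]]]|].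
  by exists (a + a')%MM, b'; rewrite addmA; split=> //; exists a, a'.
case=> [_ [b [[a [a' [Aa Aa' ->]]] Ab ->]]].
exists a, (a' + b)%MM; rewrite addmA; split=> //.
by apply/IHk; exists a', b.
Qed.

Lemma mpow_mul A k N m : upclosed A -> mpow A (k * N) m <-> mpow (mpow A k) N m.
Proof.
move=> Aup; elim: N m => [|N IHN] m; first by rewrite muln0.
rewrite mulnS mpow_add //; split=> -[a [b [Aa Ab ->]]]; exists a, b; split=> //.
  exact/IHN.
exact/IHN.
Qed.

Lemma mpow_sub A N m : upclosed A -> (0 < N)%N -> mpow A N m -> A m.
Proof. by case: N => // N Aup _ [a [b [Aa _ ->]]]; apply: upclosedD. Qed.

Lemma ideal_powE A (I : S -> Prop) k : upclosed A ->
    (forall f, I f <-> monideal A f) ->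
  forall f, ideal_pow I k f <-> monideal (mpow A k) f.
Proof.
move=> Aup IA; elim: k => [|k IHk] f; first by split.
split=> [|hf].
  apply: gen_monideal; first exact: mpow_up.
  by move=> _ [g [h [/IA Ig /IHk Ih ->]]]; apply: monidealM.
apply: monideal_gen hf => m [a [b [Aa Ab ->]]].
exists 1, ('X_[a] * 'X_[b]); rewrite mul1r mpolyXD; split=> //.
by exists 'X_[a], 'X_[b]; split=> //; [apply/IA/monidealX|apply/IHk/monidealX].
Qed.

Lemma colonX A (J : S -> Prop) g f : (forall f, J f <-> monideal A f) ->
  colon J 'X_[g] f <-> (forall m, m \in msupp f -> A (g + m)%MM).
Proof.
move=> JA; rewrite /colon JA; split=> hf m.
  move=> mf; apply: hf.
  by rewrite (perm_mem (msuppMX f g)) map_f.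
by rewrite (perm_mem (msuppMX f g)) => /mapP[m' /hf + ->].
Qed.

Lemma colonX_varideal A (J : S -> Prop) g s : (forall f, J f <-> monideal A f) ->
    (forall m, A (g + m)%MM <-> has (fun j => m j != 0%N) s) ->
  ideal_eq (colon J 'X_[g]) (varideal s).
Proof.
move=> JA gs f; rewrite colonX; last exact: JA.
by split=> hf m /hf/gs.
Qed.

Lemma associated_varideal (J : S -> Prop) g s :
  ideal_eq (colon J 'X_[g]) (varideal s) -> associated J (varideal s).
Proof. by move=> e; split; [exact: varideal_prime | exists 'X_[g]]. Qed.

(* Maximizing the exponents truncated at [D] over the monomials above [v]
   outside the ideal: the truncated exponents decide membership. *)
Lemma prime_colon_above A D v : upclosed A -> generated_in A D -> ~ A v ->
  exists2 g, (v <= g)%MM &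
    forall m, A (g + m)%MM <->
      has (fun j => m j != 0%N) (enum [set j | (g j < D)%N]).
Proof.
move=> Aup AD nv; pose cap g := (\sum_(j < n) minn (g j) D)%N.
have cap_le g : (cap g <= n * D)%N.
  rewrite -[n in (n * _)%N]card_ord -sum_nat_const.
  by apply: leq_sum => j _; apply: geq_minr.
have [t] := ubnP (n * D - cap v); elim: t v nv => // t IHt v nv capv.
have [[j [vj nvj]]|maxv] := classic (exists j, (v j < D)%N /\ ~ A (v + U_(j))%MM).
  have [|g vg gP] := IHt _ nvj; last first.
    by exists g => //; apply: lepm_trans vg; exact: lem_addr.
  have : (cap v < cap (v + U_(j))%MM)%N.
    rewrite /cap (bigD1 j) // [X in (_ < X)%N](bigD1 j) //= mnmDE mnm1E eqxx.
    rewrite -addSn leq_add //; first by lia.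
    by apply: leq_sum => i _; rewrite mnmDE; lia.
  by move: capv; have := cap_le (v + U_(j))%MM; lia.
exists v; first exact: lepm_refl.
move=> m; split; last first.
  case/hasP=> j; rewrite mem_enum inE => vj mj.
  have : A (v + U_(j))%MM by apply: NNPP => h; apply: maxv; exists j.
  move/(upclosed_le Aup); apply; apply/mnm_lepP => i; rewrite !mnmDE leq_add2l mnm1E.
  by case: eqP => [<-|] //; rewrite lt0n.
(* If [m] avoids the variables of exponent below [D] in [v], a generator dividing [v + m] already
   divides [v]: its other exponents are at most its degree [D]. *)
move=> Am; apply: contra_notT nv => /hasPn h.
case: (AD _ Am) => u [Au du um]; apply: upclosed_le Aup Au _.
apply/mnm_lepP => j; have [vj|vj] := ltnP (v j) D.
  have := mnm_lepP um j; rewrite mnmDE.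
  by have := h j; rewrite mem_enum inE vj negbK => /(_ isT)/eqP->; rewrite addn0.
apply: leq_trans vj; rewrite -du mdegE (bigD1 j) //=; exact: leq_addr.
Qed.

End MonomialIdeals.

(** * The v-number *)

Section VNumber.
Variables (K : fieldType) (n : nat).
Local Notation S := {mpoly K[n]}.

Lemma linear_resolution_monomials (B : 'X_{1..n} -> Prop) D (J : S -> Prop) m :
    generated_in B D -> (forall f, J f <-> monideal B f) -> B m ->
  has_linear_resolution J -> linear_monomials K B D.
Proof.
move=> BD JB /BD[u [Bu du _]] [d' [F [[Fg Fres _] Fsh]]].
have [FJ _ _] := Fres.
(* The generator [u] of degree [D] is a combination of entries of [aug F], which have degree [d'];
   these entries lie in [J], so conversely [d'] is at least [D]. *)
have ed : d' = D.
  have /FJ[v ev] : J 'X_[u] by apply/JB/monidealX.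
  have : u \in msupp ('X_[u] : S) by rewrite msuppX mem_head.
  rewrite -ev mxE => /msupp_sum_le/flattenP[l /mapP[q _ ->]].
  case/msuppM_le/allpairsP=> -[m1 m2] /= [m1q _ eu].
  have Jq : J (aug F ord0 q).
    by apply/FJ; exists (delta_mx q ord0); rewrite -colE mxE.
  have dm1 : mdeg m1 = d'.
    have := Fg.1 q; rewrite /homog_entry Fsh addn0 subn0 /= => /dhomog_mf.
    by move/(_ m1 m1q).
  have := generated_in_mdeg BD (iffLR (JB _) Jq m1 m1q).
  move: du; rewrite eu mdegD dm1; lia.
rewrite ed in Fsh => s i b su sf bD z cz ez.
have Bdeg m' : B m' -> (D <= mdeg m')%N by exact: generated_in_mdeg.
exact: (linear_vanishing su sf Fg Fres Fsh JB Bdeg bD cz ez).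
Qed.

Lemma ex_max_card (T : finType) (P : {set T} -> Prop) C0 : P C0 ->
  exists2 C, P C & (#|C0| <= #|C|)%N /\ forall C', P C' -> (#|C'| <= #|C|)%N.
Proof.
have [t] := ubnP (#|T| - #|C0|); elim: t C0 => // t IHt C0 lt PC0.
have [[C1 [PC1 lt01]]|h] := classic (exists C1, P C1 /\ (#|C0| < #|C1|)%N).
  have [|C PC [le Cmax]] := IHt C1 _ PC1.
    by have : (#|C1| <= #|T|)%N := max_card _; move: lt lt01; lia.
  by exists C => //; split=> //; apply: leq_trans le; apply: ltnW.
exists C0 => //; split=> // C1 PC1; rewrite leqNgt; apply/negP => lt1.
by apply: h; exists C1.
Qed.

(** The degree outside [C] is at least [D - c] for each of the [N] factors. *)
Lemma mpow_wt (B : 'X_{1..n} -> Prop) D C c N m :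
    (forall m, B m -> (c <= wt C m)%N /\ (D + wt C m <= mdeg m + c)%N) ->
  mpow B N m -> (D * N + wt C m <= mdeg m + c * N)%N.
Proof.
move=> Bwt; elim: N m => [|N IHN] m; first by rewrite !muln0 addn0 leq_wt.
case=> a [b [/Bwt[_ wa] /IHN wb ->]]; rewrite wtD mdegD !mulnS; lia.
Qed.

(** * The prime of maximal support and its witness *)

Section Socle.
Variables (I : S -> Prop) (A : 'X_{1..n} -> Prop) (d k : nat).
Hypotheses (A_up : upclosed A) (A_gen : generated_in A d).
Hypothesis I_monomial : forall f, I f <-> monideal A f.
Hypotheses (k_gt0 : (0 < k)%N) (d_gt0 : (0 < d)%N).
Hypothesis I_no_embedded :
  forall N, (1 <= N)%N -> no_embedded_primes (ideal_pow I N).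
Hypothesis I_linear : has_linear_resolution (ideal_pow I k).
Variable m0 : 'X_{1..n}.
Hypothesis Am0 : A m0.

Local Notation B := (mpow A k).
Local Notation D := (d * k)%N.

Let B_up : upclosed B. Proof. exact: mpow_up. Qed.
Let B_gen : generated_in B D. Proof. exact: mpow_gen. Qed.
Let D_gt0 : (0 < D)%N. Proof. by rewrite muln_gt0 d_gt0. Qed.

Lemma mpow_mem : B (m0 *+ k)%MM.
Proof.
elim: k => [//|k' IHk] /=; exists m0, (m0 *+ k')%MM; split=> //.
by rewrite mulmS.
Qed.

Lemma B_linear : linear_monomials K B D.
Proof.
apply: linear_resolution_monomials mpow_mem I_linear => //.
exact: ideal_powE.
Qed.

Lemma subset_varideal (C C' : {set 'I_n}) :
  C \subset C' -> ideal_sub (varideal (K := K) (enum C)) (varideal (enum C')).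
Proof.
by move=> sub f; apply: varideal_sub => j; rewrite !mem_enum; apply: (subsetP sub).
Qed.

Lemma varideal_subset (C C' : {set 'I_n}) :
  ideal_sub (varideal (K := K) (enum C)) (varideal (enum C')) -> C \subset C'.
Proof.
move=> sub; apply/subsetP => j jC.
have /sub/varidealX/hasP[i] : varideal (K := K) (enum C) 'X_j.
  by apply: varidealXU; rewrite mem_enum.
by rewrite mem_enum mnm1E; case: (j =P i) => [->|].
Qed.

(* [C] is chosen of maximal cardinality among the sets of variables multiplying
   some monomial of degree [D N - 1] into the [N]-th power.  Maximality makes [C]
   closed under linear relations; the primes found below and above
   [varideal (enum C)] coincide because the [N]-th power has no embedded
   primes. *)
Lemma exists_socle : exists (C : {set 'I_n}) c u,
  [/\ C != set0, forall m, B m -> mdeg m = D -> wt C m = c, ~ B u &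
      forall i, i \in C -> B (u + U_(i))%MM] /\ (0 < c)%N.
Proof.
pose R (C : {set 'I_n}) := exists N v, [/\ (0 < N)%N, (mdeg v).+1 = (D * N)%N &
  forall i, i \in C -> mpow B N (v + U_(i))%MM].
have [u0 [Bu0 du0 _]] := B_gen mpow_mem.
have [|i0 ui0] := @exists_var n u0; first by rewrite du0 D_gt0.
have [|C [N [v [N0 dv vC]]] [Cne Cmax]] := @ex_max_card _ R [set i0].
  exists 1%N, (u0 - U_(i0))%MM; rewrite muln1 -(mdeg_subU ui0); split=> //.
  move=> i; rewrite inE => /eqP->; rewrite subUK //.
  by exists u0, 0%MM; rewrite addm0.
have {}Cne : C != set0 by rewrite -card_gt0 (leq_trans _ Cne) // cards1.
have C_closed1 w i j : (mdeg w).+1 = D ->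
    B (w + U_(i))%MM -> B (w + U_(j))%MM -> i \in C -> j \in C.
  move=> dw wi wj iC; apply: contraT => jC.
  (* The product of [v], [w] and the variable [i] serves the larger set: for [j] it regroups as
     [(w + U_(j)) + (v + U_(i))], for [l] in [C] as [(w + U_(i)) + (v + U_(l))]. *)
  have : R (j |: C).
    exists N.+1, (v + w + U_(i))%MM; split=> //.
      by rewrite !mdegD mdeg1 mulnS; lia.
    move=> l; rewrite !inE => /orP[/eqP->|lC].
      exists (w + U_(j))%MM, (v + U_(i))%MM; split=> //; first exact: vC.
      by apply/mnmP => x; rewrite !mnmDE; lia.
    exists (w + U_(i))%MM, (v + U_(l))%MM; split=> //; first exact: vC.
    by apply/mnmP => x; rewrite !mnmDE; lia.
  by move/Cmax; rewrite cardsU1 jC add1n ltnn.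
have C_closed w i j : (mdeg w).+1 = D -> B (w + U_(i))%MM -> B (w + U_(j))%MM ->
    (i \in C) = (j \in C).
  by move=> dw wi wj; apply/idP/idP; [apply: C_closed1 wj | apply: C_closed1 wi].
pose c := wt C u0.
have Bc m : B m -> mdeg m = D -> wt C m = c.
  by move=> Bm dm; apply: (gen_wt B_up B_gen B_linear C_closed).
have Bwt := M_wt B_gen Bc.
have [i1 i1C] := set0Pn _ Cne.
(* If [c = 0], then [v + U_(i1)], of degree [D * N], would have its whole degree outside [C],
   although it involves [i1]. *)
have c0 : (0 < c)%N.
  have := mpow_wt Bwt (vC _ i1C); rewrite wtD wtU i1C mdegD mdeg1 -dv.
  by case: (c) => // /=; rewrite mul0n; lia.
have MN_up : upclosed (mpow B N) by exact: mpow_up.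
have MN_gen : generated_in (mpow B N) (D * N) by exact: mpow_gen.
have MN_ideal : forall f, ideal_pow I (k * N) f <-> monideal (mpow B N) f.
  move=> f; rewrite (ideal_powE (k * N) A_up I_monomial).
  by split=> hf m /hf /(mpow_mul k N m A_up).
have v_notin : ~ mpow B N v.
  by move/(generated_in_mdeg MN_gen); rewrite -dv ltnn.
have [g1 vg1 g1P] := prime_colon_above MN_up MN_gen v_notin.
set C1 := [set j | (g1 j < D * N)%N] in g1P.
have CC1 : C \subset C1.
  apply/subsetP => i iC; have : mpow B N (g1 + U_(i))%MM.
    apply: upclosed_le MN_up (vC _ iC) _; apply/mnm_lepP => j.
    by rewrite !mnmDE leq_add2r; apply: (mnm_lepP vg1).
  move/g1P/hasP=> [j]; rewrite mem_enum mnm1E.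
  by case: (i =P j) => [->|].
(* A product of powers of the variables outside [C]: it is not in [B] because [c > 0], and the prime
   above it can only involve variables of [C]. *)
pose inv e : 'X_{1..n} := [multinom if j \in C then 0%N else e | j < n].
have wt_inv e : wt C (inv e) = 0%N.
  by rewrite /wt big1 // => j jC; rewrite mnmE jC.
have inv_notin e : ~ B (inv e).
  by move/Bwt => [+ _]; rewrite wt_inv leqNgt c0.
have [u iu uP] := prime_colon_above B_up B_gen (inv_notin D).
set C0 := [set j | (u j < D)%N] in uP.
have inv_sub e g : (inv e <= g)%MM -> [set j | (g j < e)%N] \subset C.
  move/mnm_lepP=> ig; apply/subsetP => j; rewrite inE; apply: contraTT => jC.
  by rewrite -leqNgt; have := ig j; rewrite mnmE (negPf jC).
have C0C : C0 \subset C by exact: inv_sub.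
(* The same device with [C0]. If [v2] were in the N-th power, it would be in [B], hence in the colon
   by [u], and so would involve a variable of [C0]. *)
pose v2 : 'X_{1..n} := [multinom if j \in C0 then 0%N else (D * N)%N | j < n].
have v2_notin : ~ mpow B N v2.
  move/(mpow_sub B_up N0) => Bv2; have : B (u + v2)%MM.
    by rewrite addmC; apply: upclosedD.
  by move/uP/hasP=> [j]; rewrite mem_enum mnmE => ->.
have [g2 vg2 g2P] := prime_colon_above MN_up MN_gen v2_notin.
set C2 := [set j | (g2 j < D * N)%N] in g2P.
have C2C0 : C2 \subset C0.
  apply/subsetP => j; rewrite inE; apply: contraTT => jC.
  by rewrite -leqNgt; have := mnm_lepP vg2 j; rewrite mnmE (negPf jC).
have as1 := associated_varideal (colonX_varideal MN_ideal g1P).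
have as2 := associated_varideal (colonX_varideal MN_ideal g2P).
have kN : (1 <= k * N)%N by rewrite muln_gt0 k_gt0.
(* The chain is [C2], [C0], [C], [C1] in increasing order; both ends give associated primes of the
   same power, so all four sets coincide. *)
have C2C1 : C2 \subset C1 by apply: subset_trans CC1; apply: subset_trans C0C.
have eq12 := I_no_embedded kN as2 as1 (subset_varideal C2C1).
have C1C2 : C1 \subset C2 by apply: varideal_subset => f /eq12.
have CC0 : C \subset C0.
  by apply: subset_trans CC1 _; apply: subset_trans C1C2 _.
exists C, c, u; split=> //; split=> //.
  move=> Bu; have : B (u + 0)%MM by rewrite addm0.
  by move/uP/hasP=> [j _]; rewrite mnm0E.
move=> i iC; apply/uP/hasP; exists i; last by rewrite mnm1E eqxx.
by rewrite mem_enum (subsetP CC0).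
Qed.

Lemma exists_linear_witness : exists v s,
  (mdeg v).+1 = D /\ ideal_eq (colon (ideal_pow I k) 'X_[v]) (varideal s).
Proof.
have [C [c [u [[Cne Bc nBu Bu] c0]]]] := exists_socle.
have [v [dv wv vC]] := linear_witness B_up B_gen B_linear Bc Cne nBu Bu.
exists v, (enum C); split=> //.
apply: (colonX_varideal (A := B)); first exact: ideal_powE.
move=> m; split=> [Bm|/hasP[i]].
  (* Without variables of [C] in [m], the product [v + m] keeps C-degree [c - 1], too small for
     [B]. *)
  apply: contraT => /hasPn m0C; have [] := M_wt B_gen Bc Bm.
  rewrite wtD -wv; have -> : wt C m = 0%N; last by lia.
  rewrite /wt big1 // => i iC; have := m0C i.
  by rewrite mem_enum negbK iC => /(_ isT)/eqP.
rewrite mem_enum => iC mi; apply: upclosed_le B_up (vC i iC) _.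
apply/mnm_lepP => j; rewrite !mnmDE leq_add2l mnm1E.
by case: eqP => [<-|] //; rewrite lt0n.
Qed.

End Socle.

End VNumber.

(** * Lower bound for the degree of a witness *)

Section LowerBound.
Variables (K : fieldType) (n : nat).
Local Notation S := {mpoly K[n]}.

Lemma prime_ideal_eq (p q : S -> Prop) :
  ideal_eq p q -> prime_ideal p -> prime_ideal q.
Proof.
move=> pq [[p0 pD pM] p1 pP]; split.
- split; first exact/pq.
    by move=> f g /pq hf /pq hg; apply/pq/pD.
  by move=> r f /pq hf; apply/pq/pM.
- by move/pq.
- by move=> f g /pq/pP[] /pq; [left|right].
Qed.

Lemma prime_ideal_var (p : S -> Prop) (m : 'X_{1..n}) :
  prime_ideal p -> p 'X_[m] -> exists i : 'I_n, p 'X_i.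
Proof.
move=> [_ p1 pP]; have [t et] : exists t, t = mdeg m by eexists.
elim: t m et => [|t IHt] m em.
  by move/esym/eqP: em; rewrite mdeg_eq0 => /eqP->; rewrite mpolyX0.
have [|i mi] := @exists_var n m; first by rewrite -em.
rewrite -(subUK mi) mpolyXD => /pP[|pi]; last by exists i.
by apply: IHt; move: em; rewrite (mdeg_subU mi) => -[].
Qed.

Lemma maxidealE (f : S) : maxideal f <-> varideal (enum 'I_n) f.
Proof.
pose V (m : 'X_{1..n}) : Prop := has (fun j => m j != 0%N) (enum 'I_n).
split; last first.
  apply: monideal_gen => m /hasP[i _ mi].
  by exists 'X_[m - U_(i)], 'X_i; rewrite -mpolyXD subUK //; split=> //; exists i.
apply: (@gen_monideal K n V) => [m j /hasP[i ei mi]|_ [i ->]].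
  by apply/hasP; exists i; rewrite // mnmDE addn_eq0 negb_and mi.
exact/varidealXU/mem_enum.
Qed.

(** The prime contains [J], hence some variable; its product with the nonzero form [f] is a form of
    degree [e + 1] in [J]. *)
Lemma v_witness_ge (B : 'X_{1..n} -> Prop) D (J : S -> Prop) m e :
    generated_in B D -> (forall f, J f <-> monideal B f) -> upclosed B -> B m ->
  v_witness J e -> (D <= e.+1)%N.
Proof.
move=> BD JB Bup Bm [f [p [hf [pp _] fp]]].
have [i pi] : exists i : 'I_n, p 'X_i.
  apply: (prime_ideal_var (m := m) pp); apply/fp/JB; rewrite mulrC.
  by apply: monidealMl => //; apply/monidealX.
have f0 : f != 0.
  apply/eqP => f0; case: pp => _ p1 _; apply: p1; apply/fp/JB.
  by rewrite f0 mulr0; exact: monideal0.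
have [l lf] : exists l, l \in msupp f.
  case e0: (msupp f) => [|l s]; last by exists l; rewrite mem_head.
  by move: f0; rewrite -msupp_eq0 e0.
have /fp/JB/(_ (U_(i) + l)%MM) := pi.
rewrite mulrC addmC (perm_mem (msuppMX f U_(i))) addmC map_f // => /(_ isT) Bl.
have := generated_in_mdeg BD Bl.
by rewrite mdegD mdeg1 (dhomog_mf hf lf) add1n.
Qed.

End LowerBound.

(** * The v-number of the powers, from the witness and the lower bound *)

Theorem theorem5p4 (K : fieldType) (n : nat) (I : {mpoly K[n]} -> Prop)
    (d a : nat)
    (I_ideal : is_ideal I)
    (I_proper : ~ I 1)
    (I_gen : generated_by_monomials_of_degree I d)
    (I_linear : has_linear_powers I)
    (I_no_embedded : forall k : nat, (1 <= k)%N ->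
       no_embedded_primes (ideal_pow I k))
    (I_alpha : is_alpha I a) :
  forall k : nat, (1 <= k)%N ->
    (* with the v-number taken over d >= 1, a prime ideal other than the graded
       maximal ideal has v-number 1, so the formula fails for such I^k *)
    (prime_ideal (ideal_pow I k) -> ideal_eq (ideal_pow I k) maxideal) ->
    is_vnumber (ideal_pow I k) (a * k - 1)%N.
Proof.
move=> k k_gt0 J_prime; case: I_gen => G [Gd IG].
pose A (m : 'X_{1..n}) := exists g, G g /\ (g <= m)%MM.
have A_up : upclosed A.
  move=> m j [g [Gg gm]]; exists g; split=> //.
  exact: lepm_trans gm (lem_addr _ _).
have A_gen : generated_in A d.
  move=> m [g [Gg gm]]; exists g; split=> //; last exact: Gd.
  by exists g; split=> //; exact: lepm_refl.
have IA f : I f <-> monideal A f.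
  split=> [/IG|hf].
    apply: gen_monideal => // _ [m [Gm ->]]; apply/monidealX.
    by exists m; split=> //; exact: lepm_refl.
  apply/IG; apply: monideal_gen hf => m [g [Gg gm]].
  by exists 'X_[m - g], 'X_[g]; rewrite -mpolyXD submK //; split=> //; exists g.
have [[m0 [/IA/monidealX Am0 dm0]] a_min] := I_alpha.
have [u0 [Au0 du0 _]] := A_gen _ Am0.
have -> : a = d.
  apply/eqP; rewrite eqn_leq -{1}du0 -dm0 (generated_in_mdeg A_gen Am0) andbT dm0.
  exact/a_min/IA/monidealX.
(* A generator of degree 0 would be 1, against properness. *)
have d_gt0 : (0 < d)%N.
  rewrite lt0n; apply/eqP => d0; apply: I_proper.
  move: Au0; have /eqP := du0; rewrite d0 mdeg_eq0 => /eqP-> A0.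
  by apply/IA; rewrite -(@mpolyX0 n K); apply/monidealX.
have B_up : upclosed (mpow A k) by exact: mpow_up.
have B_gen : generated_in (mpow A k) (d * k) by exact: mpow_gen.
have JB : forall f, ideal_pow I k f <-> monideal (mpow A k) f by exact: ideal_powE.
have Bm := mpow_mem k Am0.
have [u [Bu du _]] := B_gen _ Bm.
have D_gt0 : (0 < d * k)%N by rewrite muln_gt0 d_gt0.
have [J_max|J_max] := classic (ideal_eq (ideal_pow I k) maxideal).
  (* A variable in [I^k] forces [d * k <= 1], so the truncated difference is the conventional value
     0. *)
  left; split=> //; apply/eqP; rewrite subn_eq0.
  have [|i _] := @exists_var n u; first by rewrite du.
  have /J_max/JB/monidealX : maxideal ('X_i : {mpoly K[n]}).
    by apply/maxidealE/varidealXU/mem_enum.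
  by move/(generated_in_mdeg B_gen); rewrite mdeg1.
have D_neq1 : (d * k)%N != 1%N.
  (* With [d * k = 1] the power is generated by variables, hence prime, and the hypothesis on primes
     makes it the excluded maximal ideal. So [d * k - 1] is at least 1, as the definition of the
     v-number demands. *)
  apply/eqP => D1; apply/J_max/J_prime.
  have [T TP] : exists T : 'I_n -> bool, forall i, T i <-> mpow A k U_(i)%MM.
    apply: (@fin_all_exists _ (fun=> bool)
      (fun i b => b <-> mpow A k U_(i)%MM)) => i.
    by have [h|h] := classic (mpow A k U_(i)%MM); [exists true|exists false].
  apply: (prime_ideal_eq _ (varideal_prime K (enum T))) => f; rewrite JB.
  split=> hf m /hf.
    case/hasP=> i; rewrite mem_enum => /TP Bi mi.
    apply: upclosed_le B_up Bi _; apply/mnm_lepP => j; rewrite mnm1E.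
    by case: (i =P j) => [<-|] //; rewrite lt0n.
  case/B_gen=> w [Bw /eqP]; rewrite D1 => /mdeg1P[i /eqP ew] /mnm_lepP/(_ i).
  rewrite ew mnm1E eqxx => mi; apply/hasP; exists i; last by rewrite -lt0n.
  by rewrite mem_enum; apply/TP; rewrite -ew.
right; split=> //.
- move=> f /JB hf; apply/maxidealE => m /hf/(generated_in_mdeg B_gen) dm.
  have [|i mi] := @exists_var n m; first exact: leq_trans dm.
  by apply/hasP; exists i; rewrite ?mem_enum.
- split; first by lia.
  have [v [s [dv ev]]] := exists_linear_witness A_up A_gen IA k_gt0 d_gt0
    I_no_embedded (I_linear k k_gt0) Am0.
  exists 'X_[v], (varideal s); split=> //; first by rewrite dhomogX /= -dv subn1.
  exact: associated_varideal ev.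
- move=> e _ /(v_witness_ge B_gen JB B_up Bm); lia.
Qed.
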